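(* (i) Let $p,q\in\mathcal{P}([0,1])$ with $1/p(x)+1/q(x)=1$ and let $(R(t))_{t>0}\subseteq L(X,Y)$ be a strongly continuous operator family. Let $g:\mathbb{R}\to X$ be such that $\check g:\mathbb{R}\to X$ is Stepanov $p(x)$-bounded, and suppose that for each $t\ge0$ the series $S(t):=\sum_{k=0}^\infty\|R(\cdot+t+k)\|_{L^{q(\cdot)}[0,1]}$ is convergent. Then the function $$H_1(t):=\int_t^\infty R(s)g(t-s)\,ds,\quad t\ge0,$$ is well-defined. Furthermore, $H_1$ is continuous provided that the Bochner transform $\hat{\check g}:\mathbb{R}\to L^{p(x)}([0,1]:X)$ is uniformly continuous, and $\lim_{t\to+\infty}H_1(t)=0$ provided that $\lim_{t\to+\infty}S(t)=0$. (ii) Let $(R(t))_{t>0}\subseteq L(X,Y)$ be a strongly continuous operator family such that $\int_0^\infty\|R(s)\|_{L(X,Y)}\,ds<\infty$. Let $F,F_1:(0,\infty)\times[0,\infty)\to(0,\infty)$ and let $q:[0,\infty)\to X$ be equi-Weyl-$(1,x,F)$-vanishing. Suppose that for each $\epsilon>0$ there exists $l_0>0$ such that for each $l>l_0$ there exists $t_{0,l}>0$ such that for each $t\ge t_{0,l}$ $$\sup_{x\ge0}\Biggl[F_1(l,t)\int_0^{x+t}\Bigl[\int_{x+t}^{x+t+l}\|R(s-r)\|_{L(X,Y)}\,ds\Bigr]\|q(r)\|\,dr\Biggr]<\epsilon ,$$ and that there exists a finite constant $M>0$ with $F_1(l,t)/F(l,t)\le M$ for all $l>0$, $t\ge0$.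 Then the function $$H_2(t):=\int_0^tR(t-s)q(s)\,ds,\quad t\ge0,$$ is equi-Weyl-$(1,x,F_1)$-vanishing.
   Context: $X,Y$ are complex Banach spaces; $L(X,Y)$ is the space of bounded linear operators from $X$ to $Y$; $\check g(t):=g(-t)$. $\mathcal{P}([0,1])$ is the set of Lebesgue measurable $p:[0,1]\to[1,\infty]$ (with $1/\infty=0$). For $t\ge 0$: $\varphi_{p(x)}(t)=t^{p(x)}$ if $p(x)<\infty$; if $p(x)=\infty$, $\varphi_{p(x)}(t)=0$ for $0\le t\le 1$ and $\varphi_{p(x)}(t)=\infty$ for $t>1$. $L^{p(x)}([0,1]:X)$ consists of measurable $u:[0,1]\to X$ with $\int_0^1\varphi_{p(x)}(\lambda\|u(x)\|)dx<\infty$ for some $\lambda>0$, with norm $\|u\|_{L^{p(\cdot)}[0,1]}=\inf\{\lambda>0:\int_0^1\varphi_{p(x)}(\|u(x)\|/\lambda)\,dx\le 1\}$; $\|R(\cdot+t+k)\|_{L^{q(\cdot)}[0,1]}$ is the norm of $v\mapsto\|R(v+t+k)\|_{L(X,Y)}$. A measurable $f:\mathbb{R}\to X$ is Stepanov $p(x)$-bounded iff $f(\cdot+t)\in L^{p(x)}([0,1]:X)$ for all $t\in\mathbb{R}$ and $\sup_{t\in\mathbb{R}}\|f(\cdot+t)\|_{L^{p(\cdot)}[0,1]}<\infty$. The Bochner transform of $f$ is $\hat f(t)(s):=f(t+s)$, $t\in\mathbb{R}$, $s\in[0,1]$. For $F:(0,\infty)\times[0,\infty)\to(0,\infty)$ and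 a Banach space $Z$, a function $q:[0,\infty)\to Z$ is equi-Weyl-$(1,x,F)$-vanishing (i.e. with exponent $p\equiv1$ and $\phi(x)=x$) iff $\|q(t+\cdot)\|\in L^1[x,x+l]$ for all $t,x,l>0$ and $$\lim_{l\to+\infty}\limsup_{t\to+\infty}\sup_{x\ge0}\Bigl[F(l,t)\int_x^{x+l}\|q(t+v)\|\,dv\Bigr]=0 .$$
   Formalization: Part (ii) additionally assumes that q is Bochner integrable on [0,a] for every a>0 (otherwise H_2 may be undefined, e.g. R(s)=max(0,1-s), q(s)=1/s on (0,1), q=0 elsewhere, F=F_1=1), and H_2(t) is asserted to exist for almost every t≥0. *)

(* Defs.v *)
From HB Require Import structures.
From mathcomp Require Import all_boot all_order all_algebra.
From mathcomp Require Import complex.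
From mathcomp Require Import all_classical all_reals all_analysis.
From mathcomp Require Import measurable_realfun.

Set Implicit Arguments.
Unset Strict Implicit.
Unset Printing Implicit Defensive.

Import Order.TTheory GRing.Theory Num.Theory.
Import numFieldNormedType.Exports.

Local Open Scope classical_set_scope.
Local Open Scope ring_scope.

Section norms.
Context {R : realType}.

(* The norm of a normed space over [R[i]] takes its values in [R[i]]; [rnorm]
   is the same norm read in [R]. *)
Definition rnorm {V : normedModType R[i]} (x : V) : R := complex.Re `|x|.

Definition opnorm {X Y : normedModType R[i]} (A : {linear X -> Y}) : R :=
  sup [set rnorm (A x) | x in [set x : X | rnorm x <= 1]].

Definition strongly_continuous_family {X Y : normedModType R[i]}
    (A : R -> {linear X -> Y}) : Prop :=
  (forall t, 0 < t -> continuous (A t)) /\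
  (forall x, {within `]0, +oo[, continuous (fun t => A t x)}).

End norms.

Section bochner.
Context d (T : measurableType d) (R : realType) (V : normedModType R[i]).
Variable mu : {measure set T -> \bar R}.
Implicit Types (D : set T) (f s : T -> V).

Definition vsimple s : Prop :=
  finite_set (range s) /\ forall y, measurable (s @^-1` [set y]).

Definition strongly_measurable D f : Prop :=
  exists sn : nat -> T -> V, (forall n, vsimple (sn n)) /\
    {ae mu, forall x, D x -> sn n x @[n --> \oo] --> f x}.

(* The summand for [y = 0] vanishes even when its level set has infinite
   measure, since then [fine] returns [0] (and [c *: 0 = 0] anyway). *)
Definition vsimple_integral D s : V :=
  \sum_(y \in range s) (real_complex R (fine (mu (D `&` s @^-1` [set y])))) *: y.

Definition bochner_approx D f (sn : nat -> T -> V) : Prop :=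
  [/\ forall n, vsimple (sn n) /\
        (\int[mu]_(x in D) (rnorm (sn n x))%:E < +oo)%E,
      {ae mu, forall x, D x -> sn n x @[n --> \oo] --> f x} &
      (\int[mu]_(x in D) (rnorm (f x - sn n x)%R)%:E @[n --> \oo] --> 0)%E].

Definition bochner_integrable D f : Prop := exists sn, bochner_approx D f sn.

(* Junk value [0] when [f] is not Bochner integrable on [D]. *)
Definition bochner_integral D f : V :=
  xget 0 [set v | exists2 sn, bochner_approx D f sn &
    vsimple_integral D (sn n) @[n --> \oo] --> v].

End bochner.

(* Lebesgue measure on the sigma-algebra of all Lebesgue (not only Borel)
   measurable sets; its measurable space is [lebT R], a copy of [R]. *)
Notation leb R := (@completed_lebesgue_measure R).
Notation lebT R := (caratheodory_type ((@wlength R idfun)^*)%mu).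

Section variable_exponent.
Context {R : realType}.

(* The case [-oo] never occurs for exponents with values in [[1, +oo]]. *)
Definition varphi (p : \bar R) (t : R) : \bar R :=
  match p with
  | r%:E => (t `^ r)%:E
  | +oo => if (t <= 1)%R then 0 else +oo
  | -oo => 0
  end%E.

Definition variable_exponent (p : R -> \bar R) : Prop :=
  @measurable_fun _ _ (lebT R) (\bar R) `[0, 1] p /\
  (forall x : R, 0 <= x <= 1 -> (1 <= p x)%E).

Definition modular (p : R -> \bar R) (h : R -> R) : \bar R :=
  \int[leb R]_(x in `[0, 1]) varphi (p x) (h x).

(* [+oo] when no [lambda] is admissible. *)
Definition Lpx_norm (p : R -> \bar R) (h : R -> R) : \bar R :=
  ereal_inf [set lambda%:E | lambda in
    [set lambda : R | 0 < lambda /\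
      (modular p (fun x => (h x / lambda)%R) <= 1)%E]].

Context {V : normedModType R[i]}.
Implicit Types (p : R -> \bar R) (u f : R -> V).

Definition Lpx p u : Prop :=
  strongly_measurable (leb R) `[0, 1] u /\
  exists2 lambda : R, 0 < lambda &
    (modular p (fun x => (lambda * rnorm (u x))%R) < +oo)%E.

Definition stepanov_bounded p f : Prop :=
  [/\ strongly_measurable (leb R) setT f,
      forall t, Lpx p (fun s => f (s + t)) &
      (ereal_sup [set Lpx_norm p (fun s => rnorm (f (s + t)%R)) | t in setT]
        < +oo)%E].

Definition bochner_transform f : R -> R -> V := fun t s => f (t + s).

(* Uniform continuity of [phi : R -> L^{p(x)}([0,1]:V)] for the metric of the
   norm of [L^{p(x)}]. *)
Definition Lpx_uniformly_continuous p (phi : R -> R -> V) : Prop :=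
  forall e : R, 0 < e -> exists2 delta : R, 0 < delta &
    forall t t', `|t - t'| < delta ->
      (Lpx_norm p (fun s => rnorm (phi t s - phi t' s)%R) < e%:E)%E.

End variable_exponent.

Section weyl.
Context {R : realType} {V : normedModType R[i]}.
Implicit Types (F : R -> R -> R) (q : R -> V).

(* Only the values of [F] on ]0, +oo[ x [0, +oo[ and of [q] on [0, +oo[
   matter. *)
Definition equi_Weyl_vanishing F q : Prop :=
  (forall t x l, 0 < t -> 0 < x -> 0 < l ->
    (leb R).-integrable `[x, (x + l)] (fun v => (rnorm (q (t + v)))%:E)) /\
  (limf_esup (fun t : R =>
      ereal_sup [set (F l t)%:E *
          \int[leb R]_(v in `[x, (x + l)%R]) (rnorm (q (t + v)%R))%:E
        | x in [set x : R | (0 <= x)%R]])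
    (pinfty_nbhs R) @[l --> pinfty_nbhs R] --> 0)%E.

End weyl.

(* Main.v *)
Require Import Defs.
From HB Require Import structures.
From mathcomp Require Import all_boot all_order all_algebra.
From mathcomp Require Import complex.
From mathcomp Require Import all_classical all_reals all_analysis.
From mathcomp Require Import measurable_realfun.
From mathcomp Require Import ring lra.

(** Why the statement holds.

    Both parts rest on one way of producing Bochner integrals. A map is called separably
    measurable when its values can be approximated by a sequence [c] of vectors and its
    distances to all vectors are measurable functions. The point nearest to [f x] among
    [0] and the first [n] terms of [c] is then a simple function of [x], it converges to
    [f x], and the error is at most [|f x|] ([separably_measurable_approx]); by dominated
    convergence [f] is Bochner integrable as soon as its norm is integrable. For a
    strongly continuous family [A], a measurable [s] and a separably measurable [q], the
    map [x |-> A (s x) (q x)] is separably measurable ([separably_measurable_apply]).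
    Since the measure is complete, integrands may be replaced by such representatives
    almost everywhere. All that remains are estimates of scalar integrals, together with
    the bound of the distance of two Bochner integrals by the integral of the distance
    ([bochner_integral_dist]).

    Part (i). With [f s = g (- s)], one has [H1 t] = integral of [A s (f (s - t))] over
    [s > t]. Young's inequality for the pointwise exponents yields Hoelder's inequality
    with constant [2]; summing it over unit intervals bounds the integral of [|A s| b s]
    over [s > t] by [2 c S(t)] whenever [b] has local norms below [c]
    ([integral_opnorm_le_series]). Taking [b s = |f (s - t)|] gives integrability and the
    decay of [H1]. For continuity at [t], the passage from [f (s - t')] to [f (s - t)]
    under the integral over [s > t'] costs at most [2 e S(0)], where [e] bounds the local
    norms of the difference; what is then left is the integral of the fixed function
    [A s (f (s - t))] between [t] and [t'], small by absolute continuity.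

    Part (ii). By Tonelli's theorem the scalar convolution [W] of [|A|] and [|q|] is
    integrable on bounded intervals, so it is finite almost everywhere, and there the
    integrand of [H2] is integrable. The integrand is separably measurable on the plane;
    sections of its simple approximations have integrals that are finite sums of vectors
    with measurable coefficients, so the norm of [H2] is measurable
    ([measurable_convolution_integral]). Integrating [|H2| <= W] over
    [x + t, x + t + l] and exchanging the integrals, the part with [r <= x + t] is the
    expression in the hypothesis, and the rest is at most the integral of [|A|] times
    the integral of [|q|] over that interval ([integral_convolution_le]). Multiplying by
    [F1 <= M * F] and taking suprema and limits gives the claim. *)

Set Implicit Arguments.
Unset Strict Implicit.
Unset Printing Implicit Defensive.

Import Order.TTheory GRing.Theory Num.Theory.
Import numFieldNormedType.Exports.

Local Open Scope classical_set_scope.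
Local Open Scope ring_scope.

(** * Norms read in the reals *)

Section rnorm_theory.
Context {R : realType} {V : normedModType R[i]}.
Implicit Types (x y z : V).

Lemma normr_rnorm x : `|x| = (rnorm x)%:C%C.
Proof. by rewrite /rnorm RRe_real// normr_real. Qed.

Lemma rnorm_ge0 x : 0 <= rnorm x.
Proof. by rewrite -lecR -normr_rnorm normr_ge0. Qed.

Lemma rnorm0 : rnorm (0 : V) = 0.
Proof. by rewrite /rnorm normr0. Qed.

Lemma rnormN x : rnorm (- x) = rnorm x.
Proof. by rewrite /rnorm normrN. Qed.

Lemma rnorm_distC x y : rnorm (x - y) = rnorm (y - x).
Proof. by rewrite /rnorm distrC. Qed.

Lemma ler_rnormD x y : rnorm (x + y) <= rnorm x + rnorm y.
Proof. by rewrite -lecR rmorphD /= -!normr_rnorm ler_normD. Qed.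

Lemma ler_rnormB x y : rnorm (x - y) <= rnorm x + rnorm y.
Proof. by rewrite -[rnorm y]rnormN ler_rnormD. Qed.

Lemma ler_rnorm_distD z x y : rnorm (x - y) <= rnorm (x - z) + rnorm (z - y).
Proof. by rewrite -lecR rmorphD /= -!normr_rnorm ler_distD. Qed.

Lemma ler_rnorm_dist x y : `|rnorm x - rnorm y| <= rnorm (x - y).
Proof.
have h (a b : V) : rnorm a - rnorm b <= rnorm (a - b).
  by have := ler_rnormD (a - b) b; rewrite subrK lerBlDr.
by rewrite ler_norml h andbT lerNl opprB rnorm_distC h.
Qed.

Lemma rnormZ (c : R) x : rnorm (c%:C%C *: x) = `|c| * rnorm x.
Proof.
apply: complexI; rewrite rmorphM /= -!normr_rnorm normrZ; congr (_ * _).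
by rewrite normc_def /= expr0n addr0 sqrtr_sqr.
Qed.

Lemma rnorm_eq0 x : rnorm x = 0 -> x = 0.
Proof. by move=> x0; apply/normr0_eq0; rewrite normr_rnorm x0. Qed.

Lemma ler_rnorm_sum (I : Type) (r : seq I) (F : I -> V) :
  rnorm (\sum_(i <- r) F i) <= \sum_(i <- r) rnorm (F i).
Proof.
elim/big_ind2 : _ => [|x1 x2 y1 y2 h1 h2|//]; first by rewrite rnorm0.
by rewrite (le_trans (ler_rnormD _ _))// lerD.
Qed.

Lemma cvg_rnormP (T : Type) (F : set_system T) {FF : Filter F} (f : T -> V) l :
  f @ F --> l <-> rnorm (f t - l) @[t --> F] --> (0 : R).
Proof.
split => [/cvgr_dist_lt fl|/cvgr_dist_lt fl]; apply/cvgrPdist_lt.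
  move=> e e0; have /fl : (0 : R[i]) < e%:C%C by rewrite ltcR.
  apply: filterS => t; rewrite normr_rnorm ltcR rnorm_distC.
  by rewrite sub0r normrN ger0_norm// rnorm_ge0.
move=> e e0.
have /andP[/eqP Ime Ree] : (complex.Im e == 0) && (0 < complex.Re e).
  by move: e0; rewrite ltcE /=.
have := fl _ Ree.
apply: filterS => t; rewrite normr_rnorm rnorm_distC.
rewrite sub0r normrN ger0_norm ?rnorm_ge0// => h.
by rewrite ltcE /= Ime eqxx.
Qed.

End rnorm_theory.

Lemma nbhs_rnormP (R : realType) (V : normedModType R[i]) (x : V) (P : set V) :
  nbhs x P <-> exists2 e : R, 0 < e & forall y, rnorm (y - x) < e -> P y.
Proof.
split=> [/nbhs_normP[e /= e0 xP]|[e e0 xP]].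
  move: e0; rewrite ltcE /= => /andP[/eqP Ime Ree].
  exists (complex.Re e) => // y xy; apply: xP => /=.
  by rewrite distrC normr_rnorm ltcE/= Ime eqxx.
apply/nbhs_normP; exists e%:C%C; first by rewrite /= ltcR.
by move=> y /=; rewrite normr_rnorm ltcR rnorm_distC; exact: xP.
Qed.

Section opnorm_theory.
Context {R : realType} {X Y : normedModType R[i]}.
Implicit Types (A : {linear X -> Y}) (x : X).

(** Continuity at [0] gives a ball of radius [e] mapped into the unit ball, and scaling
    by [e / 2 / |x|] brings every nonzero vector into
    that ball. *)
Lemma linear_rnorm_bounded A : continuous A ->
  exists2 M : R, 0 <= M & forall x, rnorm (A x) <= M * rnorm x.
Proof.
move=> cA; have /cvg_rnormP/cvgr_dist_lt/(_ 1 ltr01) := cA 0.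
move=> /nbhs_rnormP[e e0 eA].
exists (e / 2)^-1; first by rewrite invr_ge0 divr_ge0// ltW.
move=> x; have [x0|x0] := eqVneq (rnorm x) 0.
  by rewrite (rnorm_eq0 x0) linear0 !rnorm0 mulr0.
have {}x0 : 0 < rnorm x by rewrite lt_def x0 rnorm_ge0.
have e2 : 0 < e / 2 by rewrite divr_gt0.
have := eA ((e / 2 / rnorm x)%:C%C *: x).
have e2x : 0 <= e / 2 / rnorm x by rewrite divr_ge0 ?(ltW e2) ?(ltW x0).
rewrite subr0 rnormZ (ger0_norm e2x).
have h2 : e / 2 < e by rewrite ltr_pdivrMr// ltr_pMr// ltr1n.
rewrite divfK ?gt_eqF// => /(_ h2).
rewrite linear0 subr0 sub0r normrN ger0_norm ?rnorm_ge0// linearZ /= rnormZ.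
rewrite (ger0_norm e2x) => /ltW.
by rewrite mulrAC ler_pdivrMr// mul1r -ler_pdivlMl.
Qed.

Lemma has_sup_opnorm A : continuous A ->
  has_sup [set rnorm (A x) | x in [set x : X | rnorm x <= 1]].
Proof.
move=> /linear_rnorm_bounded[M M0 AM]; split.
  by exists (rnorm (A 0)); exists 0 => //=; rewrite rnorm0.
exists M => _ [x /= x1 <-].
by rewrite (le_trans (AM x))// ler_piMr.
Qed.

Lemma opnorm_ge0 A : 0 <= opnorm A.
Proof.
rewrite /opnorm; set E := [set _ | _ in _].
have [hE|hE] := pselect (has_sup E); last by rewrite sup_out.
by apply: ub_le_sup; [case: hE|exists 0 => /=; rewrite ?linear0 ?rnorm0].
Qed.

(** Only for a continuous operator is [opnorm] a supremum of a bounded set; for an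
    unbounded one it is the default value of [sup]. *)
Lemma ler_opnorm A x : continuous A -> rnorm (A x) <= opnorm A * rnorm x.
Proof.
move=> cA; have [x0|x0] := eqVneq (rnorm x) 0.
  by rewrite (rnorm_eq0 x0) linear0 !rnorm0 mulr0.
have {}x0 : 0 < rnorm x by rewrite lt_def x0 rnorm_ge0.
have : rnorm (A ((rnorm x)^-1%:C%C *: x)) <= opnorm A.
  apply: ub_le_sup; first exact: (has_sup_opnorm cA).2.
  exists ((rnorm x)^-1%:C%C *: x) => //=.
  by rewrite rnormZ ger0_norm ?invr_ge0 ?rnorm_ge0// mulVf ?gt_eqF.
rewrite linearZ /= rnormZ ger0_norm ?invr_ge0 ?rnorm_ge0//.
by rewrite ler_pdivrMl// mulrC.
Qed.

Lemma opnorm_gt A (c : R) : 0 <= c -> continuous A -> c < opnorm A ->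
  exists2 x, rnorm x <= 1 & c < rnorm (A x).
Proof.
move=> c0 cA cA'; have := sup_gt (has_sup_opnorm cA).1 cA'.
by move=> [_ [x x1 <-] cx]; exists x.
Qed.

Lemma opnorm_ub A x : continuous A -> rnorm x <= 1 -> rnorm (A x) <= opnorm A.
Proof.
by move=> cA x1; rewrite (le_trans (ler_opnorm _ cA))// ler_piMr// opnorm_ge0.
Qed.

End opnorm_theory.

(** * Separably measurable maps *)

(** Pettis's description of strong measurability: the sequence [c] comes arbitrarily near
    every value, and [f] is seen only through its distances to vectors. This class is
    stable under pointwise limits and under composition with measurable maps, also on
    product spaces. *)
Definition separably_measurable {d} {T : measurableType d} {R : realType}
    {V : normedModType R[i]} (f : T -> V) : Prop :=
  (exists c : nat -> V, forall x (e : R), 0 < e -> exists k, rnorm (f x - c k) < e) /\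
  (forall v, measurable_fun setT (fun x => rnorm (f x - v))).

(** Freezing the second argument: on each of the countably many level sets of [s] the
    map coincides with one of the measurable functions [F ^~ w]. *)
Lemma measurable_fun_countable_range d d' (T : measurableType d)
    (U : measurableType d') (W : Type) (s : T -> W) (c : nat -> W) (F : T -> W -> U) :
  (forall x, exists k, s x = c k) ->
  (forall w, measurable (s @^-1` [set w])) ->
  (forall w, measurable_fun setT (F ^~ w)) ->
  measurable_fun setT (fun x => F x (s x)).
Proof.
move=> sc ms mF _ B mB; rewrite setTI.
have -> : (fun x => F x (s x)) @^-1` B =
    \bigcup_k ((s @^-1` [set c k]) `&` ((F ^~ (c k)) @^-1` B)).
  apply/seteqP; split => [x /= Bx|x [k _ [/= -> //]]].
  by have [k sk] := sc x; exists k => //=; rewrite -sk.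
apply: bigcupT_measurable => k; apply: measurableI; first exact: ms.
by rewrite -[X in measurable X]setTI; exact: mF.
Qed.

Lemma countable_enum (I : countType) (W : Type) (w0 : W) (c : I -> W) :
  exists c' : nat -> W, forall i, exists k, c' k = c i.
Proof.
exists (fun k => if unpickle k is Some i then c i else w0) => i.
by exists (pickle i); rewrite pickleK.
Qed.

Lemma finite_range_enum (T : Type) (W : eqType) (s : T -> W) (w0 : W) :
  finite_set (range s) -> exists c : nat -> W, forall x, exists k, s x = c k.
Proof.
move=> /finite_seqP[r rE]; exists (nth w0 r) => x.
have /= : [set` r] (s x) by rewrite -rE; exists x.
by move=> /(nthP w0)[k _ <-]; exists k.
Qed.

Section vsimple_theory.
Context d (T : measurableType d) (R : realType) (V : normedModType R[i]).

Lemma vsimple_if (s s' : T -> V) (b : T -> bool) : vsimple s -> vsimple s' ->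
  measurable_fun setT b -> vsimple (fun x => if b x then s x else s' x).
Proof.
move=> [fs ms] [fs' ms'] mb; split.
  apply: (@sub_finite_set _ _ (range s `|` range s')); last by rewrite finite_setU.
  by move=> _ [x _ <-]; case: ifP => _; [left|right]; exists x.
move=> y; have mt : measurable (b @^-1` [set true]).
  by rewrite -[X in measurable X]setTI; exact: mb.
rewrite (_ : _ @^-1` _ = (b @^-1` [set true] `&` s @^-1` [set y]) `|`
    (~` (b @^-1` [set true]) `&` s' @^-1` [set y])).
  apply: measurableU; apply: measurableI => //.
  exact: measurableC.
apply/seteqP; split => x /=; case: ifPn => bx.
- by left.
- by right.
- by case=> [[]//|[/(_ erefl)]].
- by case=> [[]//|[]].
Qed.

Lemma vsimple_cst (v : V) : vsimple (fun _ : T => v).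
Proof.
split; first by apply: (@sub_finite_set _ _ [set v]) => // _ [x _ <-].
move=> y; have [->|vy] := eqVneq v y.
  by rewrite (_ : _ @^-1` _ = setT)//; apply/seteqP; split.
rewrite (_ : _ @^-1` _ = set0)//; apply/seteqP; split => // x /= /eqP.
by rewrite (negbTE vy).
Qed.

End vsimple_theory.

Lemma measurable_fun_mem d (T : measurableType d) (D : set T) : measurable D ->
  measurable_fun setT (fun x => x \in D).
Proof.
move=> mD; apply: (measurable_fun_bool true) => //; rewrite setTI.
rewrite (_ : _ @^-1` _ = D)//.
by apply/seteqP; split => x /=; [move/set_mem|move/mem_set].
Qed.

Section nearest.
Context d (T : measurableType d) (R : realType) (V : normedModType R[i]).
Variables (f : T -> V) (c : nat -> V).

(** [nearest n x] is a point closest to [f x] among [0, c 0, ..., c n.-1], ties being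
    resolved in favour of the earlier one. *)
Fixpoint nearest n x : V := if n is m.+1 then
  if rnorm (f x - c m) < rnorm (f x - nearest m x) then c m else nearest m x
  else 0.

Let nearestS n x : rnorm (f x - nearest n.+1 x) =
  Num.min (rnorm (f x - c n)) (rnorm (f x - nearest n x)).
Proof. by rewrite /= minElt; case: ifP. Qed.

(** The value [0] is among the candidates, so the error never exceeds the norm of [f x]:
    this is the domination that makes the approximation converge in mean. *)
Lemma nearest_le_norm n x : rnorm (f x - nearest n x) <= rnorm (f x).
Proof.
elim: n => [|n ih]; first by rewrite subr0.
by rewrite nearestS ge_min ih orbT.
Qed.

Lemma nearest_le n k x : (k < n)%N ->
  rnorm (f x - nearest n x) <= rnorm (f x - c k).
Proof.
elim: n => // n ih; rewrite ltnS leq_eqVlt nearestS ge_min => /predU1P[->|/ih ->].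
  by rewrite lexx.
by rewrite orbT.
Qed.

Hypothesis fc : forall x (e : R), 0 < e -> exists k, rnorm (f x - c k) < e.

Lemma cvg_nearest x : rnorm (f x - nearest n x) @[n --> \oo] --> (0 : R).
Proof.
apply/cvgrPdist_lt => e e0; have [k fk] := fc x e0.
exists k.+1 => // n /= kn; rewrite sub0r normrN ger0_norm ?rnorm_ge0//.
exact: le_lt_trans (nearest_le _ kn) fk.
Qed.

Hypothesis mf : forall v, measurable_fun setT (fun x => rnorm (f x - v)).

Lemma measurable_dist_nearest n :
  measurable_fun setT (fun x => rnorm (f x - nearest n x)).
Proof.
elim: n => [|n ih]; first exact: mf.
rewrite (_ : (fun _ => _) = (fun x => rnorm (f x - c n)) \min
  (fun x => rnorm (f x - nearest n x))).
  exact: measurable_minr.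
by apply/funext => x; rewrite nearestS.
Qed.

Lemma vsimple_nearest n : vsimple (nearest n).
Proof.
elim: n => [|n ih]; first exact: vsimple_cst.
apply: vsimple_if => //; first exact: vsimple_cst.
apply: measurable_fun_ltr; first exact: mf.
exact: measurable_dist_nearest.
Qed.

End nearest.

Section separably_measurable_theory.
Context d (T : measurableType d) (R : realType) (V : normedModType R[i]).
Implicit Types f g s : T -> V.

Lemma separably_measurable_norm f : separably_measurable f ->
  measurable_fun setT (fun x => rnorm (f x)).
Proof. by move=> [_ /(_ 0)]; under eq_fun do rewrite subr0. Qed.

(** The simple functions are the nearest points of [f] in longer and longer pieces of its
    dense sequence; the bound on the error lets dominated convergence apply with
    [|f|] itself as dominating function. *)
Lemma separably_measurable_approx f : separably_measurable f ->
  exists sn : nat -> T -> V, [/\ forall n, vsimple (sn n),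
    forall n x, rnorm (f x - sn n x) <= rnorm (f x),
    forall x, rnorm (f x - sn n x) @[n --> \oo] --> (0 : R) &
    forall n, measurable_fun setT (fun x => rnorm (f x - sn n x))].
Proof.
move=> [[c fc] mf]; exists (nearest f c); split.
- by move=> n; exact: vsimple_nearest.
- by move=> n x; exact: nearest_le_norm.
- by move=> x; exact: cvg_nearest.
- by move=> n; exact: measurable_dist_nearest.
Qed.

Lemma cvg_rnorm_dist (u : nat -> V) l v : rnorm (l - u n) @[n --> \oo] --> (0 : R) ->
  rnorm (u n - v) @[n --> \oo] --> rnorm (l - v).
Proof.
move=> /cvgrPdist_lt ul; apply/cvgrPdist_lt => e e0; have := ul _ e0.
apply: filterS => n; rewrite sub0r normrN ger0_norm ?rnorm_ge0//.
apply: le_lt_trans; rewrite (le_trans (ler_rnorm_dist _ _))//.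
by rewrite opprB addrA subrK.
Qed.

(** The dense sequences of the [g n] together are dense near the range of the limit, and
    distances to a vector pass to the limit. *)
Lemma separably_measurable_cvg (g : nat -> T -> V) f :
  (forall n, separably_measurable (g n)) ->
  (forall x, rnorm (f x - g n x) @[n --> \oo] --> (0 : R)) ->
  separably_measurable f.
Proof.
move=> mg gf; split; last first.
  move=> v; apply: (@measurable_fun_cvg _ _ _ _ (fun n x => rnorm (g n x - v))).
    by move=> n; have [_] := mg n; exact.
  by move=> x _; exact: cvg_rnorm_dist.
pose c n : nat -> V := sval (cid (proj1 (mg n))).
have cP n x (e : R) : 0 < e -> exists k, rnorm (g n x - c n k) < e.
  by rewrite /c; case: cid => /= c' + e0; exact.
have [c' cc'] := countable_enum 0 (fun p : nat * nat => c p.1 p.2).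
exists c' => x e e0; have e2 : 0 < e / 2 by rewrite divr_gt0.
have /cvgrPdist_lt/(_ _ e2)[n _ /(_ n (leqnn n))] := gf x.
rewrite sub0r normrN ger0_norm ?rnorm_ge0// => fgn.
have [m gm] := cP n x _ e2.
have [k ck] := cc' (n, m); exists k; rewrite ck.
rewrite (le_lt_trans (ler_rnorm_distD (g n x) _ _))// (splitr e) ltrD//.
Qed.

Lemma vsimple_separably_measurable s : vsimple s -> separably_measurable s.
Proof.
move=> [fs ms]; have [c sc] := finite_range_enum 0 fs; split.
  exists c => x e e0; have [k ->] := sc x; exists k.
  by rewrite subrr rnorm0.
move=> v; apply: (measurable_fun_countable_range (F := fun _ y => rnorm (y - v)) sc ms).
by move=> w; exact: measurable_cst.
Qed.

Lemma separably_measurable_comp d' (T' : measurableType d') (h : T' -> T) f :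
  measurable_fun setT h -> separably_measurable f -> separably_measurable (f \o h).
Proof.
move=> mh [[c fc] mf]; split; first by exists c => x e /=; exact: fc.
by move=> v; apply: (measurableT_comp (mf v) mh).
Qed.

Lemma separably_measurable_if f g (b : T -> bool) : measurable_fun setT b ->
  separably_measurable f -> separably_measurable g ->
  separably_measurable (fun x => if b x then f x else g x).
Proof.
move=> mb [[c fc] mf] [[c' gc] mg]; split.
  have [c1 cc1] := countable_enum 0 (fun p : bool * nat =>
    if p.1 then c p.2 else c' p.2).
  exists c1 => x e e0.
  case: ifP => bx.
    by have [k fk] := fc x _ e0; have [j cj] := cc1 (true, k); exists j; rewrite cj.
  by have [k fk] := gc x _ e0; have [j cj] := cc1 (false, k); exists j; rewrite cj.
move=> v; under eq_fun do rewrite fun_if if_arg.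
rewrite (_ : (fun _ => _) = (fun x => if b x then rnorm (f x - v) else rnorm (g x - v))).
  exact: measurable_fun_ifT.
by apply/funext => x; case: ifP.
Qed.

Lemma separably_measurable_cst (v : V) : separably_measurable (fun _ : T => v).
Proof. exact/vsimple_separably_measurable/vsimple_cst. Qed.

Lemma separably_measurable_dist f g : separably_measurable f ->
  separably_measurable g -> measurable_fun setT (fun x => rnorm (f x - g x)).
Proof.
move=> mf mg; have [sn [sn1 _ sn3 _]] := separably_measurable_approx mg.
apply: (@measurable_fun_cvg _ _ _ _ (fun n x => rnorm (f x - sn n x))).
  move=> n; have [fs ms] := sn1 n; have [c sc] := finite_range_enum 0 fs.
  apply: (measurable_fun_countable_range (F := fun x y => rnorm (f x - y)) sc ms).
  by move=> w; have [_] := mf; exact.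
move=> x _; under eq_fun do rewrite rnorm_distC.
by rewrite rnorm_distC; exact: cvg_rnorm_dist.
Qed.

End separably_measurable_theory.

Section operator_family.
Context {R : realType} {X Y : normedModType R[i]}.
Variables (A : R -> {linear X -> Y}).
Hypothesis sA : strongly_continuous_family A.

(** Nothing is known about [A t] for [t <= 0]; norms and values are replaced by [0] there,
    which keeps them measurable on the whole line. *)
Definition pos_opnorm (t : R) : R := if 0 < t then opnorm (A t) else 0.

Definition pos_apply (t : R) (x : X) : Y := if 0 < t then A t x else 0.

Lemma pos_opnorm_ge0 t : 0 <= pos_opnorm t.
Proof. by rewrite /pos_opnorm; case: ifP => // _; exact: opnorm_ge0. Qed.

Lemma ler_pos_opnorm t x : rnorm (pos_apply t x) <= pos_opnorm t * rnorm x.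
Proof.
rewrite /pos_apply /pos_opnorm; case: ifPn => t0; last by rewrite rnorm0 mul0r.
by apply: ler_opnorm; exact: sA.1.
Qed.

Lemma strongly_continuous_near (t : R) (x : X) (e : R) : 0 < t -> 0 < e ->
  \forall s \near t, 0 < s /\ rnorm (A s x - A t x) < e.
Proof.
move=> t0 e0; have := sA.2 x.
rewrite continuous_open_subspace; last exact: interval_open.
move=> /(_ t); rewrite inE/= in_itv/= t0 => /(_ isT) /cvg_rnormP.
move=> /cvgrPdist_lt/(_ _ e0) h; near=> s; split.
  by near: s; exact: lt_nbhsr.
have : `|0 - rnorm (A s x - A t x)| < e by near: s.
by rewrite sub0r normrN ger0_norm// rnorm_ge0.
Unshelve. all: by end_near. Qed.

Lemma measurable_pos_apply (x : X) (v : Y) :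
  measurable_fun setT (fun t => rnorm (pos_apply t x - v)).
Proof.
rewrite /pos_apply (_ : (fun _ => _) =
  (fun t => if 0 < t then rnorm (A t x - v) else rnorm (0 - v))); last first.
  by apply/funext => t; case: ifP.
apply: measurable_fun_if => //; first exact: measurable_fun_ltr.
rewrite setTI (_ : _ @^-1` _ = `]0, +oo[%classic); last first.
  by apply/seteqP; split => t /=; rewrite in_itv/= andbT.
apply: open_continuous_measurable_fun; first exact: interval_open.
move=> t; rewrite inE/= in_itv/= andbT => t0.
apply/cvgrPdist_lt => e e0; have := strongly_continuous_near x t0 e0.
apply: filterS => s [_]; apply: le_lt_trans.
by rewrite distrC (le_trans (ler_rnorm_dist _ _))// opprB addrA subrK.
Qed.

(** A supremum of the functions [t |-> |A t x|], continuous on ]0, +oo[, is lower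
    semicontinuous, and the extension by [0] keeps this because norms are nonnegative. *)
Lemma measurable_pos_opnorm : measurable_fun setT pos_opnorm.
Proof.
apply/measurable_EFinP; apply: lower_semicontinuous_measurable => t a /=.
rewrite lte_fin /pos_opnorm; case: ifPn => [t0 at0|_ a0]; last first.
  exists setT; first exact: filterT.
  by move=> s _; rewrite /= lte_fin (lt_le_trans a0)// pos_opnorm_ge0.
have [a0|a0] := ltP a 0.
  exists setT; first exact: filterT.
  by move=> s _; rewrite /= lte_fin (lt_le_trans a0)// pos_opnorm_ge0.
have [x x1 ax] := opnorm_gt a0 (sA.1 _ t0) at0.
have := strongly_continuous_near x t0 (_ : 0 < rnorm (A t x) - a); rewrite subr_gt0 => /(_ ax) h.
eexists; first exact: h.
move=> s /= [s0 sx]; rewrite s0 lte_fin.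
apply: lt_le_trans (opnorm_ub (sA.1 _ s0) x1).
have := ler_rnorm_dist (A s x) (A t x); rewrite ler_norml => /andP[+ _].
by lra.
Qed.

(** Strong continuity is enough for both halves. Density: [A s x] is close to [A s (c k)]
    because [A s] is continuous, and this to [A r (c k)] for a rational [r] close to
    [s]. Measurability of the distances: replace [q] by simple functions, for which the
    second argument can be frozen, and pass to the limit. *)
Lemma separably_measurable_apply d (T : measurableType d) (sg : T -> R) (q : T -> X) :
  measurable_fun setT sg -> separably_measurable q ->
  separably_measurable (fun x => pos_apply (sg x) (q x)).
Proof.
move=> msg mq; split.
  have [[c qc] _] := mq.
  have [c' cc'] := countable_enum 0 (fun o : option (nat * rat) =>
    if o is Some (k, r) then A (ratr r) (c k) else 0).
  exists c' => x e e0; rewrite /pos_apply; case: ifPn => s0; last first.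
    by have [k ck] := cc' None; exists k; rewrite ck subrr rnorm0.
  have M0 : 0 < opnorm (A (sg x)) + 1 by rewrite ltr_wpDl ?opnorm_ge0.
  have e2 : 0 < e / 2 by rewrite divr_gt0.
  have [k qk] := qc x _ (divr_gt0 e2 M0).
  have /nbhs_ballP[dl /= dl0 rs] := strongly_continuous_near (c k) s0 e2.
  have [r] : exists r : rat, ratr r \in `](sg x - dl), (sg x + dl)[.
    by apply: rat_in_itvoo; lra.
  rewrite in_itv/= => /andP[r1 r2].
  have [|_ Ar] := rs (ratr r); first by rewrite /ball/= ltr_distlC r1 r2.
  have [j cj] := cc' (Some (k, r)); exists j; rewrite cj.
  rewrite (le_lt_trans (ler_rnorm_distD (A (sg x) (c k)) _ _))// (splitr e) ltrD//.
    rewrite -linearB (le_lt_trans (ler_opnorm _ (sA.1 _ s0)))//.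
    move: qk; rewrite ltr_pdivlMr// mulrC; apply: le_lt_trans.
    by rewrite ler_wpM2r ?rnorm_ge0// lerDl.
  by rewrite rnorm_distC.
have [sn [sn1 _ sn3 _]] := separably_measurable_approx mq.
move=> v.
apply: (@measurable_fun_cvg _ _ _ _ (fun n x => rnorm (pos_apply (sg x) (sn n x) - v))).
  move=> n; have [fs ms] := sn1 n; have [c sc] := finite_range_enum 0 fs.
  apply: (measurable_fun_countable_range
    (F := fun x y => rnorm (pos_apply (sg x) y - v)) sc ms).
  by move=> w; apply: (measurableT_comp (measurable_pos_apply w v) msg).
move=> x _; apply: cvg_rnorm_dist; rewrite /pos_apply; case: ifPn => s0.
  under eq_fun do rewrite rnorm_distC.
  apply/cvg_rnormP; apply: (continuous_cvg _ (sA.1 _ s0 (q x))).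
  by apply/cvg_rnormP; under eq_fun do rewrite rnorm_distC; exact: sn3.
by under eq_fun do rewrite subrr rnorm0; exact: cvg_cst.
Qed.

End operator_family.

(** * Integrals of simple functions *)

Section simple_integral.
Context d (T : measurableType d) (R : realType) (V : normedModType R[i]).
Variable mu : {measure set T -> \bar R}.
Implicit Types (D : set T) (s : T -> V).

Lemma integral_finite_range (W : eqType) (pi : T -> W) (r : seq W) D (G : W -> R) :
  measurable D -> uniq r -> (forall x, pi x \in r) ->
  (forall w, measurable (pi @^-1` [set w])) -> (forall w, 0 <= G w) ->
  (\int[mu]_(x in D) (G (pi x))%:E =
   \sum_(w <- r) (G w)%:E * mu (D `&` pi @^-1` [set w]))%E.
Proof.
move=> mD ur rpi mpi G0.
transitivity (\int[mu]_(x in D)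
    \sum_(w <- r) (G w)%:E * (\1_(pi @^-1` [set w]) x)%:E)%E.
  apply: eq_integral => x _; rewrite (bigD1_seq (pi x))//= indicE mem_set//=.
  rewrite mule1 big1 ?adde0// => w wpi; rewrite indicE memNset ?mule0//=.
  by move/eqP; rewrite eq_sym (negbTE wpi).
have m1 w : measurable_fun D (fun x => (\1_(pi @^-1` [set w]) x)%:E : \bar R).
  by apply/measurable_EFinP; exact: measurable_indic.
rewrite ge0_integral_sum//; first last.
- by move=> w x _; rewrite mule_ge0 ?lee_fin.
- by move=> w; exact: measurable_funeM.
apply: eq_bigr => w _; rewrite ge0_integralZl//; first by rewrite integral_indic// setIC.
by rewrite lee_fin.
Qed.

Lemma vsimple_integral_seq D s (r : seq V) : uniq r -> (forall x, s x \in r) ->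
  vsimple_integral mu D s =
  \sum_(y <- r) (fine (mu (D `&` s @^-1` [set y])))%:C%C *: y.
Proof.
move=> ur rs; rewrite /vsimple_integral (@fsbig_fwiden _ _ _ _ r)//.
  by move=> _ [x _ <-] /=.
move=> y /= [_ ys]; rewrite (_ : _ @^-1` _ = set0) ?setI0 ?measure0 ?scale0r//.
by apply/seteqP; split => // x /= xy; apply: ys; exists x.
Qed.

Lemma vsimple_enum s : vsimple s -> exists2 r : seq V, uniq r & forall x, s x \in r.
Proof.
move=> [/finite_seqP[r rE] _]; exists (undup r); first exact: undup_uniq.
by move=> x; rewrite mem_undup; have /= : [set` r] (s x) by rewrite -rE; exists x.
Qed.

(** A nonzero value is taken on a set of finite measure, by Markov's inequality; hence
    [fine] loses no information in the sum defining the integral. *)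
Lemma vsimple_finite_level s : vsimple s ->
  (\int[mu]_x (rnorm (s x))%:E < +oo)%E ->
  forall y, y != 0 -> (mu (s @^-1` [set y]) < +oo)%E.
Proof.
move=> vs ioo y y0.
have ry : 0 < rnorm y.
  by rewrite lt_def rnorm_ge0 andbT; apply: contra_neq y0; exact: rnorm_eq0.
have : ((rnorm y)%:E * mu (s @^-1` [set y]) < +oo)%E.
  apply: le_lt_trans ioo; rewrite -integral_cst; last exact: vs.2.
  rewrite (eq_integral (fun x => (rnorm (s x))%:E)).
    apply: ge0_subset_integral => //; first exact: vs.2.
      apply/measurable_EFinP/separably_measurable_norm.
      exact: vsimple_separably_measurable.
    by move=> x _; rewrite lee_fin rnorm_ge0.
  by move=> x /set_mem /= ->.
move: (measure_ge0 mu (s @^-1` [set y])).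
by case: (mu _) => [a| |]// _; rewrite ?ltry// gt0_muley// lte_fin.
Qed.

(** On the common refinement of the level sets of [s] and [s'] both integrals are sums
    over the same cells, so the triangle inequality applies cell by cell. A cell of
    infinite measure can only be the one where both functions vanish. *)
Lemma vsimple_integral_dist s s' : vsimple s -> vsimple s' ->
  (\int[mu]_x (rnorm (s x))%:E < +oo)%E ->
  (\int[mu]_x (rnorm (s' x))%:E < +oo)%E ->
  ((rnorm (vsimple_integral mu setT s - vsimple_integral mu setT s'))%:E <=
   \int[mu]_x (rnorm (s x - s' x))%:E)%E.
Proof.
move=> vs vs' is_ is'.
have [r ur rs] := vsimple_enum vs; have [r' ur' rs'] := vsimple_enum vs'.
have fs := vsimple_finite_level vs is_; have fs' := vsimple_finite_level vs' is'.
(* [m y z] is the measure of a cell, with value [0] for the cell of infinite measure. *)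
pose m y z : R := fine (mu (s @^-1` [set y] `&` s' @^-1` [set z])).
have mE y z : (y != 0) || (z != 0) ->
    mu (s @^-1` [set y] `&` s' @^-1` [set z]) = (m y z)%:E.
  move=> yz; rewrite /m fineK// ge0_fin_numE ?measure_ge0//.
  have mI : measurable (s @^-1` [set y] `&` s' @^-1` [set z]).
    by apply: measurableI; [exact: vs.2|exact: vs'.2].
  case/orP : yz => [y0|z0].
    apply: le_lt_trans (fs _ y0); apply: le_measure; rewrite ?inE//.
    exact: vs.2.
  apply: le_lt_trans (fs' _ z0); apply: le_measure; rewrite ?inE//.
  exact: vs'.2.
have ES : vsimple_integral mu setT s = \sum_(y <- r) \sum_(z <- r') (m y z)%:C%C *: y.
  rewrite (vsimple_integral_seq setT ur rs); apply: eq_bigr => y _; rewrite setTI.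
  have [->|y0] := eqVneq y 0.
    by rewrite scaler0 big1// => z _; rewrite scaler0.
  rewrite -scaler_suml -rmorph_sum; congr (_ %:C%C *: _).
  rewrite -[X in fine X]mul1e -integral_cst; last exact: vs.2.
  rewrite (integral_finite_range (G := fun=> 1) (vs.2 y) ur' rs' vs'.2)//.
  by under eq_bigr do rewrite mul1e mE ?y0//; rewrite sumEFin.
have ES' : vsimple_integral mu setT s' = \sum_(y <- r) \sum_(z <- r') (m y z)%:C%C *: z.
  rewrite exchange_big /= (vsimple_integral_seq setT ur' rs').
  apply: eq_bigr => z _; rewrite setTI.
  have [->|z0] := eqVneq z 0.
    by rewrite scaler0 big1// => y _; rewrite scaler0.
  rewrite -scaler_suml -rmorph_sum; congr (_ %:C%C *: _).
  rewrite -[X in fine X]mul1e -integral_cst; last exact: vs'.2.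
  rewrite (integral_finite_range (G := fun=> 1) (vs'.2 z) ur rs vs.2)//.
  by under eq_bigr do rewrite mul1e setIC mE ?z0 ?orbT//; rewrite sumEFin.
rewrite ES ES' -sumrB.
pose pi x := (s x, s' x).
pose rr := [seq (y, z) | y <- r, z <- r'].
have EI : (\int[mu]_x (rnorm (s x - s' x))%:E =
    (\sum_(y <- r) \sum_(z <- r') m y z * rnorm (y - z))%R%:E)%E.
  rewrite (@integral_finite_range _ pi rr setT (fun w => rnorm (w.1 - w.2)))//.
  - rewrite big_allpairs_dep /= -sumEFin; apply: eq_bigr => y _.
    rewrite -sumEFin; apply: eq_bigr => z _.
    rewrite setTI (_ : pi @^-1` _ = s @^-1` [set y] `&` s' @^-1` [set z]).
      have [/= ->|yz] := eqVneq y z; first by rewrite subrr rnorm0 mulr0 mul0e.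
      rewrite mE -?EFinM 1?mulrC//; apply: contra_neqT yz.
      by rewrite negb_or !negbK => /andP[/eqP -> /eqP ->].
    by apply/seteqP; split => x /=; [case=> <- <-|case=> <- <-].
  - by apply: allpairs_uniq => // -[? ?] [? ?].
  - by move=> x; apply/allpairsP; exists (s x, s' x); rewrite rs rs'.
  - move=> [y z]; rewrite (_ : _ @^-1` _ = s @^-1` [set y] `&` s' @^-1` [set z]).
      by apply: measurableI; [exact: vs.2|exact: vs'.2].
    by apply/seteqP; split => x /=; [case=> <- <-|case=> <- <-].
  - by move=> w; exact: rnorm_ge0.
rewrite EI lee_fin (le_trans (ler_rnorm_sum _ _))//.
apply: ler_sum => y _; rewrite -sumrB (le_trans (ler_rnorm_sum _ _))//.
apply: ler_sum => z _; rewrite -scalerBr rnormZ ger0_norm//.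
by rewrite fine_ge0// measure_ge0.
Qed.

End simple_integral.

(** * The Bochner integral for a complete measure *)

Section ereal_cvg0.
Context {R : realType} {T : Type} {F : set_system T} {FF : Filter F}.
Implicit Types u : T -> \bar R.

Lemma cvge0_lt_near u (e : R) : (u t @[t --> F] --> 0)%E -> 0 < e ->
  \forall t \near F, (u t < e%:E)%E.
Proof.
move=> u0 e0; apply: (u0 [set x | (x < e%:E)%E]).
by apply: open_nbhs_nbhs; split; [exact: open_ereal_lt_ereal|rewrite /= lte_fin].
Qed.

Lemma ge0_cvge0 u : (\forall t \near F, (0 <= u t)%E) ->
  (forall e : R, 0 < e -> \forall t \near F, (u t < e%:E)%E) ->
  (u t @[t --> F] --> 0)%E.
Proof.
move=> u0 ue P P0.
have /nbhs_ballP[e /= e0 eP] : nbhs (0 : R) (fun r => P r%:E) by exact: P0.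
have := ue _ e0; apply: filterS2 u0 => t.
rewrite /preimage /=; case: (u t) => [r| |]//; rewrite lee_fin lte_fin => r0 re.
by apply: (eP r); rewrite /ball/= sub0r normrN ger0_norm.
Qed.

End ereal_cvg0.

Lemma rnorm_cauchy_cvg (R : realType) (V : completeNormedModType R[i]) (u : nat -> V) :
  (forall e : R, 0 < e -> exists N, forall n m, (N <= n)%N -> (N <= m)%N ->
    rnorm (u n - u m) < e) -> exists l : V, u n @[n --> \oo] --> l.
Proof.
move=> uC; suff : cvg (u @ \oo) by move=> /cvg_ex [l ul]; exists l.
apply: cauchy_cvg; apply: cauchy_exP => e.
rewrite ltcE /= => /andP[/eqP Ime Ree].
have [N uN] := uC _ Ree; exists (u N); exists N => // n /= Nn.
by rewrite -ball_normE /= normr_rnorm ltcE /= Ime eqxx /= uN.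
Qed.

Section bochner_theory.
Context d (T : measurableType d) (R : realType) (V : normedModType R[i]).
Variable mu : {measure set T -> \bar R}.
Hypothesis cmu : measure_is_complete mu.
Implicit Types (D : set T) (f g : T -> V).

(** Outside a null set the map is a limit of simple functions; redefining it as [0] on that
    set and outside [D] gives a separably measurable map. *)
Lemma ae_cvg_separably_measurable D f (sn : nat -> T -> V) : measurable D ->
  (forall n, vsimple (sn n)) ->
  {ae mu, forall x, D x -> sn n x @[n --> \oo] --> f x} ->
  exists f' : T -> V, [/\ separably_measurable f',
    {ae mu, forall x, D x -> f' x = f x} & forall x, ~ D x -> f' x = 0].
Proof.
move=> mD vsn [N [mN N0 snf]].
pose b x := x \in D `&` ~` N.
have mb : measurable_fun setT b.
  by apply: measurable_fun_mem; apply: measurableI => //; exact: measurableC.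
exists (fun x => if b x then f x else 0); split.
- apply: (@separably_measurable_cvg _ _ _ _ (fun n x => if b x then sn n x else 0)).
    move=> n; apply: separably_measurable_if => //.
      exact: vsimple_separably_measurable.
    exact: separably_measurable_cst.
  move=> x; case: ifPn => [/set_mem[Dx Nx]|_].
    under eq_fun do rewrite rnorm_distC; apply/cvg_rnormP.
    by apply: contrapT => h; apply: Nx; apply: snf => /= /(_ Dx).
  by under eq_fun do rewrite subrr rnorm0; exact: cvg_cst.
- exists N; split => // x /= h; apply: contrapT => Nx; apply: h => Dx.
  by rewrite /b mem_set.
- by move=> x Dx; rewrite /b memNset// => -[].
Qed.

(** Completeness of the measure transfers measurability from the representative [f'] to
    [f] itself, which is known only up to a null set. *)
Lemma ae_measurable_rnormB D f f' g : measurable D -> separably_measurable f' ->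
  {ae mu, forall x, D x -> f' x = f x} -> separably_measurable g ->
  measurable_fun D (fun x => (rnorm (f x - g x))%:E : \bar R).
Proof.
move=> mD mf' ff' mg.
apply: (ae_measurable_fun cmu (f := fun x => (rnorm (f' x - g x))%:E)).
  by apply: filterS ff' => x + Dx => /(_ Dx) ->.
apply/measurable_EFinP; apply: measurable_funTS.
exact: separably_measurable_dist.
Qed.

Lemma bochner_approx_separably D f (sn : nat -> T -> V) : measurable D ->
  bochner_approx mu D f sn ->
  exists f' : T -> V, separably_measurable f' /\
    {ae mu, forall x, D x -> f' x = f x}.
Proof.
move=> mD [h1 h2 _].
have [f' [? ? _]] := ae_cvg_separably_measurable mD (fun n => (h1 n).1) h2.
by exists f'.
Qed.

(** The convergence of Bochner integrals follows from this estimate: with [f = g] it gives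
    the Cauchy property and uniqueness of the limit, and in the limit it bounds the
    distance of two integrals. *)
Lemma bochner_approx_dist f g (sn tn : nat -> T -> V) n m :
  bochner_approx mu setT f sn -> bochner_approx mu setT g tn ->
  ((rnorm (vsimple_integral mu setT (sn n) - vsimple_integral mu setT (tn m)))%:E <=
   \int[mu]_x (rnorm (f x - g x))%:E +
   (\int[mu]_x (rnorm (f x - sn n x))%:E + \int[mu]_x (rnorm (g x - tn m x))%:E))%E.
Proof.
move=> fsn gtn; have [f' [mf' ff']] := bochner_approx_separably measurableT fsn.
have [g' [mg' gg']] := bochner_approx_separably measurableT gtn.
have [h1 _ _] := fsn; have [h1' _ _] := gtn.
have [vs is_] := h1 n; have [vs' is'] := h1' m.
apply: (le_trans (vsimple_integral_dist vs vs' is_ is')).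
have ms := vsimple_separably_measurable vs.
have ms' := vsimple_separably_measurable vs'.
have m1 : measurable_fun setT (fun x => (rnorm (f x - sn n x))%:E : \bar R).
  exact: ae_measurable_rnormB ff' ms.
have m2 : measurable_fun setT (fun x => (rnorm (g x - tn m x))%:E : \bar R).
  exact: ae_measurable_rnormB gg' ms'.
have m3 : measurable_fun setT (fun x => (rnorm (f x - g x))%:E : \bar R).
  apply: (ae_measurable_fun cmu (f := fun x => (rnorm (f' x - g' x))%:E)).
    by apply: filterS2 ff' gg' => x + + Dx => /(_ Dx) -> /(_ Dx) ->.
  by apply/measurable_EFinP; exact: separably_measurable_dist.
rewrite -!ge0_integralD//; do ?[by move=> x _; rewrite ?adde_ge0// lee_fin rnorm_ge0].
- apply: ge0_le_integral => //.
  + by move=> x _; rewrite lee_fin rnorm_ge0.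
  + apply/measurable_EFinP; exact: separably_measurable_dist.
  + by apply: emeasurable_funD => //; exact: emeasurable_funD.
  + move=> x _; rewrite -!EFinD lee_fin.
    rewrite (le_trans (ler_rnorm_distD (f x) _ _))//.
    rewrite addrCA (rnorm_distC (sn n x)) lerD2l.
    exact: ler_rnorm_distD.
- exact: emeasurable_funD.
Qed.

Lemma eq_bochner_approx D f f' (sn : nat -> T -> V) : measurable D ->
  separably_measurable f' -> {ae mu, forall x, D x -> f' x = f x} ->
  bochner_approx mu D f sn <-> bochner_approx mu D f' sn.
Proof.
move=> mD mf' ff'.
have E : (forall n, vsimple (sn n)) -> forall n,
    (\int[mu]_(x in D) (rnorm (f x - sn n x))%:E =
     \int[mu]_(x in D) (rnorm (f' x - sn n x))%:E)%E.
  move=> vsn n; have msn := vsimple_separably_measurable (vsn n).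
  apply: ge0_ae_eq_integral => //.
  - exact: ae_measurable_rnormB ff' msn.
  - by apply/measurable_EFinP/measurable_funTS; exact: separably_measurable_dist.
  - by move=> x _; rewrite lee_fin rnorm_ge0.
  - by move=> x _; rewrite lee_fin rnorm_ge0.
  - by apply: filterS ff' => x + Dx => /(_ Dx) ->.
split=> -[h1 h2 h3]; split => //.
- by apply: filterS2 ff' h2 => x + + Dx => /(_ Dx) ->; exact.
- rewrite (_ : (fun n => _) = (fun n => \int[mu]_(x in D) (rnorm (f x - sn n x))%:E)%E)//.
  by apply/funext => n; rewrite E// => m; exact: (h1 m).1.
- by apply: filterS2 ff' h2 => x + + Dx => /(_ Dx) <-; exact.
- rewrite (_ : (fun n => _) = (fun n => \int[mu]_(x in D) (rnorm (f' x - sn n x))%:E)%E)//.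
  by apply/funext => n; rewrite E// => m; exact: (h1 m).1.
Qed.

Lemma eq_bochner_integrable D f f' : measurable D ->
  separably_measurable f' -> {ae mu, forall x, D x -> f' x = f x} ->
  bochner_integrable mu D f <-> bochner_integrable mu D f'.
Proof.
by move=> mD mf' ff'; split=> -[sn /(eq_bochner_approx _ mD mf' ff')]; exists sn.
Qed.

Lemma eq_bochner_integral D f f' : measurable D ->
  separably_measurable f' -> {ae mu, forall x, D x -> f' x = f x} ->
  bochner_integral mu D f = bochner_integral mu D f'.
Proof.
move=> mD mf' ff'; rewrite /bochner_integral; congr xget.
apply/seteqP; split=> v [sn h1 h2]; exists sn => //;
  exact/(eq_bochner_approx _ mD mf' ff').
Qed.

(** Moves every integral to the whole space, where integrals over different domains can be
    compared. *)
Definition zero_outside D f : T -> V := fun x => if x \in D then f x else 0.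

Lemma vsimple_zero_outside D s : measurable D -> vsimple s ->
  vsimple (zero_outside D s).
Proof.
move=> mD vs; apply: vsimple_if => //; first exact: vsimple_cst.
exact: measurable_fun_mem.
Qed.

Lemma separably_measurable_zero_outside D f : measurable D ->
  separably_measurable f -> separably_measurable (zero_outside D f).
Proof.
move=> mD mf; apply: separably_measurable_if => //.
  exact: measurable_fun_mem.
exact: separably_measurable_cst.
Qed.

Lemma vsimple_integral_zero_outside D (s : T -> V) : vsimple s ->
  vsimple_integral mu setT (zero_outside D s) = vsimple_integral mu D s.
Proof.
move=> vs; have [r0 _ rs0] := vsimple_enum vs.
pose r := undup (0 :: r0).
have rs x : s x \in r by rewrite mem_undup inE rs0 orbT.
have rs' x : zero_outside D s x \in r.
  by rewrite /zero_outside; case: ifP => // _; rewrite mem_undup inE eqxx.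
rewrite (vsimple_integral_seq mu setT (undup_uniq _) rs').
rewrite (vsimple_integral_seq mu D (undup_uniq _) rs).
apply: eq_bigr => y _; have [->|y0] := eqVneq y 0; first by rewrite !scaler0.
congr ((fine (mu _))%:C%C *: _); rewrite setTI /zero_outside.
apply/seteqP; split => x /=; last by move=> [Dx sx]; rewrite mem_set.
by case: ifPn => [/set_mem//|_ y0']; move: y0; rewrite -y0' eqxx.
Qed.

Lemma integral_zero_outside D f (h : V -> \bar R) : h 0 = 0%E ->
  (\int[mu]_x h (zero_outside D f x) = \int[mu]_(x in D) h (f x))%E.
Proof.
move=> h0; rewrite [RHS]integral_mkcond; apply: eq_integral => x _.
by rewrite patchE /zero_outside; case: ifP.
Qed.

Lemma bochner_approx_zero_outside D f (sn : nat -> T -> V) : measurable D ->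
  bochner_approx mu D f sn ->
  bochner_approx mu setT (zero_outside D f) (fun n => zero_outside D (sn n)).
Proof.
move=> mD [h1 h2 h3]; split.
- move=> n; split; first by apply: vsimple_zero_outside => //; exact: (h1 n).1.
  rewrite (integral_zero_outside D (sn n) (h := fun v => (rnorm v)%:E)) ?rnorm0//.
  exact: (h1 n).2.
- apply: filterS h2 => x + _; rewrite /zero_outside.
  by case: ifPn => [/set_mem Dx|_ _]; [exact|exact: cvg_cst].
- rewrite (_ : (fun n => _) = (fun n => \int[mu]_(x in D) (rnorm (f x - sn n x))%:E)%E)//.
  apply/funext => n; rewrite [RHS]integral_mkcond; apply: eq_integral => x _.
  by rewrite patchE /zero_outside; case: ifP => // _; rewrite subrr rnorm0.
Qed.

End bochner_theory.

Section bochner_integral_theory.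
Context d (T : measurableType d) (R : realType) (V : completeNormedModType R[i]).
Variable mu : {measure set T -> \bar R}.
Hypothesis cmu : measure_is_complete mu.
Implicit Types (D : set T) (f g : T -> V).

Lemma bochner_approx_cvgT f sn : bochner_approx mu setT f sn ->
  exists l : V, vsimple_integral mu setT (sn n) @[n --> \oo] --> l.
Proof.
move=> fsn; apply: rnorm_cauchy_cvg => e e0.
have [_ _ h3] := fsn.
have [N _ hN] := cvge0_lt_near h3 (divr_gt0 e0 (ltr0Sn R 1)).
exists N => n m Nn Nm; rewrite -lte_fin.
apply: (le_lt_trans (bochner_approx_dist cmu n m fsn fsn)).
under eq_integral do rewrite subrr rnorm0.
rewrite integral0 add0e (splitr e) EFinD lteD//; exact: hN.
Qed.

Lemma bochner_approx_dist_lim f g sn tn (l l' : V) :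
  bochner_approx mu setT f sn -> bochner_approx mu setT g tn ->
  vsimple_integral mu setT (sn n) @[n --> \oo] --> l ->
  vsimple_integral mu setT (tn n) @[n --> \oo] --> l' ->
  ((rnorm (l - l'))%:E <= \int[mu]_x (rnorm (f x - g x))%:E)%E.
Proof.
move=> fsn gtn sl tl; have [_ _ h3] := fsn; have [_ _ h3'] := gtn.
apply/lee_addgt0Pr => e e0; have e4 : 0 < e / 4 by rewrite divr_gt0.
have slt : (vsimple_integral mu setT (sn n) - vsimple_integral mu setT (tn n))
    @[n --> \oo] --> l - l' by exact: cvgB.
move/cvg_rnormP : slt => /cvgrPdist_lt/(_ _ e4) c.
have [n] : exists n, [/\ `|0 - rnorm (vsimple_integral mu setT (sn n) -
     vsimple_integral mu setT (tn n) - (l - l'))| < e / 4,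
     (\int[mu]_x (rnorm (f x - sn n x))%:E < (e / 4)%:E)%E &
     (\int[mu]_x (rnorm (g x - tn n x))%:E < (e / 4)%:E)%E].
  have [n _ hn] : \forall n \near \oo, [/\ `|0 - rnorm (vsimple_integral mu setT (sn n) -
     vsimple_integral mu setT (tn n) - (l - l'))| < e / 4,
     (\int[mu]_x (rnorm (f x - sn n x))%:E < (e / 4)%:E)%E &
     (\int[mu]_x (rnorm (g x - tn n x))%:E < (e / 4)%:E)%E].
    by near=> n; split; near: n; [exact: c|exact: cvge0_lt_near|exact: cvge0_lt_near].
  by exists n; exact: (hn n (leqnn n)).
move=> []; rewrite sub0r normrN ger0_norm ?rnorm_ge0// => h1 h2 h2'.
have := bochner_approx_dist cmu n n fsn gtn.
set I := (\int[mu]_x (rnorm (f x - g x))%:E)%E => h.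
set v := _ - vsimple_integral _ _ _ in h1 h.
apply: (@le_trans _ _ ((rnorm v)%:E + (e / 4)%:E)%E).
  rewrite -EFinD lee_fin; have := ler_rnormB v (v - (l - l')); rewrite subKr.
  by move=> /le_trans; apply; rewrite lerD2l ltW.
apply: (@le_trans _ _ (I + ((e / 4)%:E + (e / 4)%:E) + (e / 4)%:E)%E).
  by rewrite leeD2r// (le_trans h)// leeD2l// leeD// ltW.
rewrite -addeA leeD2l// -!EFinD lee_fin; lra.
Unshelve. all: by end_near. Qed.

Lemma bochner_approx_exists_cvg D f sn : measurable D -> bochner_approx mu D f sn ->
  exists2 l : V, vsimple_integral mu D (sn n) @[n --> \oo] --> l &
    vsimple_integral mu setT (zero_outside D (sn n)) @[n --> \oo] --> l.
Proof.
move=> mD fsn.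
have [l sl] := bochner_approx_cvgT (bochner_approx_zero_outside mD fsn).
exists l => //; rewrite (_ : (fun n => _) =
  (fun n => vsimple_integral mu setT (zero_outside D (sn n))))//.
apply/funext => n; rewrite vsimple_integral_zero_outside//.
by have [h _ _] := fsn; exact: (h n).1.
Qed.

Lemma bochner_integral_spec D f : measurable D -> bochner_integrable mu D f ->
  exists2 sn, bochner_approx mu D f sn &
    vsimple_integral mu D (sn n) @[n --> \oo] --> bochner_integral mu D f.
Proof.
move=> mD [sn fsn]; apply: (@xgetPex _ 0 [set v | exists2 sn, bochner_approx mu D f sn &
    vsimple_integral mu D (sn n) @[n --> \oo] --> v]).
by have [l ? _] := bochner_approx_exists_cvg mD fsn; exists l; exists sn.
Qed.

Lemma cvg_zero_outside D f sn (l : V) : bochner_approx mu D f sn ->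
  vsimple_integral mu D (sn n) @[n --> \oo] --> l ->
  vsimple_integral mu setT (zero_outside D (sn n)) @[n --> \oo] --> l.
Proof.
move=> [h _ _]; rewrite (_ : (fun n => vsimple_integral mu setT _) =
  (fun n => vsimple_integral mu D (sn n)))//.
by apply/funext => n; rewrite vsimple_integral_zero_outside//; exact: (h n).1.
Qed.

(** The analogue of the inequality between the norm of an integral and the integral of the
    norm, for a difference of integrals over two domains. *)
Lemma bochner_integral_dist D D' f g : measurable D -> measurable D' ->
  bochner_integrable mu D f -> bochner_integrable mu D' g ->
  ((rnorm (bochner_integral mu D f - bochner_integral mu D' g))%:E <=
   \int[mu]_x (rnorm (zero_outside D f x - zero_outside D' g x))%:E)%E.
Proof.
move=> mD mD' /(bochner_integral_spec mD)[sn fsn sl].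
move=> /(bochner_integral_spec mD')[tn gtn tl].
apply: bochner_approx_dist_lim (bochner_approx_zero_outside mD fsn)
  (bochner_approx_zero_outside mD' gtn) (cvg_zero_outside fsn sl)
  (cvg_zero_outside gtn tl).
Qed.

Lemma cvg_bochner_integral D f sn : measurable D -> bochner_approx mu D f sn ->
  vsimple_integral mu D (sn n) @[n --> \oo] --> bochner_integral mu D f.
Proof.
move=> mD fsn; have [l sl sl'] := bochner_approx_exists_cvg mD fsn.
have [sn' fsn' sl2] := bochner_integral_spec mD (ex_intro _ _ fsn).
suff -> : bochner_integral mu D f = l by [].
have h := bochner_approx_zero_outside mD fsn.
have h' := bochner_approx_zero_outside mD fsn'.
have := bochner_approx_dist_lim h' h (cvg_zero_outside fsn' sl2) sl'.
under eq_integral do rewrite subrr rnorm0.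
rewrite integral0 lee_fin => ll; apply/subr0_eq/rnorm_eq0/eqP.
by rewrite eq_le ll rnorm_ge0.
Qed.

Lemma bochner_approx0 : bochner_approx mu setT (fun=> 0 : V) (fun=> fun=> 0).
Proof.
split.
- move=> n; split; first exact: vsimple_cst.
  by under eq_integral do rewrite rnorm0; rewrite integral0.
- by apply: nearW => x _; exact: cvg_cst.
- under eq_fun do under eq_integral do rewrite subrr rnorm0.
  by under eq_fun do rewrite integral0; exact: cvg_cst.
Qed.

(** When [f] is not integrable the left-hand side is the norm of the junk value [0]. *)
Lemma ler_bochner_integral D f : measurable D ->
  ((rnorm (bochner_integral mu D f))%:E <= \int[mu]_(x in D) (rnorm (f x))%:E)%E.
Proof.
move=> mD; have [fi|fi] := pselect (bochner_integrable mu D f); last first.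
  rewrite /bochner_integral xgetPN ?rnorm0.
    by apply: integral_ge0 => x _; rewrite lee_fin rnorm_ge0.
  by move=> v [sn fsn _]; apply: fi; exists sn.
have [sn fsn sl] := bochner_integral_spec mD fi.
have := bochner_approx_dist_lim (bochner_approx_zero_outside mD fsn)
  bochner_approx0 (cvg_zero_outside fsn sl) (l' := 0).
rewrite subr0; under eq_integral do rewrite subr0.
rewrite (integral_zero_outside mu D f (h := fun v => (rnorm v)%:E)) ?rnorm0//.
apply; rewrite (_ : (fun n => _) = (fun=> 0)); first exact: cvg_cst.
apply/funext => _; rewrite (@vsimple_integral_seq _ _ _ _ _ _ _ [:: 0])//.
  by rewrite big_seq1 scaler0.
by move=> x; rewrite inE.
Qed.

(** Dominated convergence, the error being bounded by [|f'|]. The sequence is left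
    arbitrary so that sections of one approximation on a product space can be used. *)
Lemma separably_measurable_bochner_approx D f' : measurable D ->
  separably_measurable f' ->
  (\int[mu]_(x in D) (rnorm (f' x))%:E < +oo)%E ->
  forall sn : nat -> T -> V, (forall n, vsimple (sn n)) ->
    (forall n x, rnorm (f' x - sn n x) <= rnorm (f' x)) ->
    (forall x, rnorm (f' x - sn n x) @[n --> \oo] --> (0 : R)) ->
  bochner_approx mu D f' sn.
Proof.
move=> mD mf' if' sn vsn snf' cvsn.
have msn n := vsimple_separably_measurable (vsn n).
have mnf' : measurable_fun D (fun x => (rnorm (f' x))%:E : \bar R).
  by apply/measurable_EFinP/measurable_funTS; exact: separably_measurable_norm.
have md n : measurable_fun D (fun x => (rnorm (f' x - sn n x))%:E : \bar R).
  by apply/measurable_EFinP/measurable_funTS; exact: separably_measurable_dist.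
have intf' : mu.-integrable D (fun x => (rnorm (f' x))%:E).
  apply/integrableP; split => //; under eq_integral do
    rewrite gee0_abs ?lee_fin ?rnorm_ge0//.
  by [].
split.
- move=> n; split => //.
  apply: (@le_lt_trans _ _ (\int[mu]_(x in D) (2%:E * (rnorm (f' x))%:E))%E).
    apply: ge0_le_integral => //.
    + by move=> x _; rewrite lee_fin rnorm_ge0.
    + by apply/measurable_EFinP/measurable_funTS; exact: separably_measurable_norm.
    + exact: measurable_funeM.
    + move=> x _; rewrite -EFinM lee_fin mulr_natl mulr2n.
      have := ler_rnormB (f' x) (f' x - sn n x); rewrite subKr => /le_trans; apply.
      by rewrite lerD2l.
  rewrite ge0_integralZl//; last by move=> x _; rewrite lee_fin rnorm_ge0.
  by rewrite lte_mul_pinfty.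
- apply: nearW => x Dx.
  by apply/cvg_rnormP; under eq_fun do rewrite rnorm_distC; exact: cvsn.
- have f1 : {ae mu, forall x, D x ->
      (rnorm (f' x - sn n x))%:E @[n --> \oo] --> (0 : \bar R)%E}.
    by apply: nearW => x Dx; apply: cvg_EFin; [exact: nearW|exact: cvsn].
  have f2 : {ae mu, forall x n, D x ->
      (`|(rnorm (f' x - sn n x))%:E| <= (rnorm (f' x))%:E)%E}.
    by apply: nearW => x n Dx; rewrite gee0_abs ?lee_fin ?rnorm_ge0.
  have [_ h _] := dominated_convergence mD md (@measurable_cst _ _ _ _ D 0%E)
    f1 intf' f2.
  rewrite (_ : (fun n => _) = (fun n =>
     \int[mu]_(x in D) `|(rnorm (f' x - sn n x))%:E - 0| )%E) //.
  apply/funext => n; apply: eq_integral => x _.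
  by rewrite sube0 gee0_abs ?lee_fin ?rnorm_ge0.
Qed.

Lemma separably_measurable_bochner_integrable D f : measurable D ->
  separably_measurable f -> (\int[mu]_(x in D) (rnorm (f x))%:E < +oo)%E ->
  bochner_integrable mu D f.
Proof.
move=> mD mf fi; have [sn [h1 h2 h3 _]] := separably_measurable_approx mf.
by exists sn; apply: separably_measurable_bochner_approx.
Qed.

End bochner_integral_theory.

Lemma bochner_approx_norm_lty d (T : measurableType d) (R : realType)
    (V : normedModType R[i]) (mu : {measure set T -> \bar R}) (D : set T) (f : T -> V)
    (sn : nat -> T -> V) : measurable D -> separably_measurable f ->
  bochner_approx mu D f sn -> (\int[mu]_(x in D) (rnorm (f x))%:E < +oo)%E.
Proof.
move=> mD mf [h1 _ h3].
have [n _ /(_ n (leqnn n)) hn] := cvge0_lt_near h3 ltr01.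
have [vs is_] := h1 n; have ms := vsimple_separably_measurable vs.
have m1 : measurable_fun D (fun x => (rnorm (f x - sn n x))%:E : \bar R).
  by apply/measurable_EFinP/measurable_funTS; exact: separably_measurable_dist.
have m2 : measurable_fun D (fun x => (rnorm (sn n x))%:E : \bar R).
  by apply/measurable_EFinP/measurable_funTS; exact: separably_measurable_norm.
apply: (@le_lt_trans _ _ (\int[mu]_(x in D) (rnorm (f x - sn n x))%:E +
   \int[mu]_(x in D) (rnorm (sn n x))%:E)%E); last first.
  apply: lte_add_pinfty; last exact: (h1 n).2.
  by apply: (lt_trans hn); rewrite ltry.
rewrite -ge0_integralD//; last 2 first.
- by move=> x _; rewrite lee_fin rnorm_ge0.
- by move=> x _; rewrite lee_fin rnorm_ge0.
apply: ge0_le_integral => //.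
- by move=> x _; rewrite lee_fin rnorm_ge0.
- by apply/measurable_EFinP/measurable_funTS; exact: separably_measurable_norm.
- exact: emeasurable_funD.
- move=> x _; rewrite -EFinD lee_fin.
  by have := ler_rnormD (f x - sn n x) (sn n x); rewrite subrK.
Qed.

(** * Translations of Lebesgue measure *)

Section translation.
Context {R : realType}.
Local Notation lam := ((@wlength R idfun)^*)%mu.

(** Translating a cover by half-open intervals gives a cover of the translated set by
    intervals of the same lengths. *)
Lemma outer_measure_shift_le (c : R) (A : set R) :
  (lam ((fun x => x + c)%R @^-1` A) <= lam A)%E.
Proof.
apply: le_ereal_inf_tmp => _ [F [mF AF] <-].
apply: ereal_inf_lbound.
exists (fun k => (fun x => x + c) @^-1` (F k)).
  split=> [k|x /= Ax]; last by have [k _ Fk] := AF _ Ax; exists k.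
  have [[a b] _ /= <-] := mF k.
  exists (a - c, b - c) => //=; apply/seteqP; split => x /=; rewrite !in_itv/=;
    by rewrite ltrBlDr lerBrDr.
apply: eq_eseriesr => k _; have [[a b] _ /= <-] := mF k.
rewrite (_ : _ @^-1` _ = `]a - c, b - c]%classic); last first.
  by apply/seteqP; split => x /=; rewrite !in_itv/= ltrBlDr lerBrDr.
rewrite !wlength_itv /= !lte_fin ltrD2r; case: ifP => // _.
by rewrite -!EFinD; congr EFin; lra.
Qed.

Lemma outer_measure_shift (c : R) (A : set R) :
  lam ((fun x => x + c) @^-1` A) = lam A.
Proof.
apply/eqP; rewrite eq_le outer_measure_shift_le /=.
have := outer_measure_shift_le (- c) ((fun x => x + c) @^-1` A).
rewrite (_ : (fun x => x + - c) @^-1` ((fun x => x + c) @^-1` A) = A)//.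
by apply/seteqP; split => x /=; rewrite subrK.
Qed.

(** The Caratheodory condition is stated with the outer measure only, so it inherits its
    translation invariance. *)
Lemma measurable_shift (c : R) :
  measurable_fun [set: lebT R] ((fun x => x + c) : lebT R -> lebT R).
Proof.
move=> _ A mA; rewrite setTI.
suff : caratheodory_measurable lam ((fun x => x + c) @^-1` A) by [].
move=> X.
pose X' := (fun x => x - c) @^-1` X.
have XE : X = (fun x => x + c) @^-1` X'.
  by apply/seteqP; split => x; rewrite /X' /= addrK.
have E : lam X' = (lam (X' `&` A) + lam (X' `&` ~` A))%E := mA X'.
rewrite [in LHS]XE outer_measure_shift E.
by rewrite -(outer_measure_shift c (X' `&` A)) -(outer_measure_shift c (X' `&` ~` A))
  !preimage_setI -XE.
Qed.

Lemma measurable_lebT (A : set R) : measurable A -> measurable (A : set (lebT R)).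
Proof. exact: sub_caratheodory. Qed.

Lemma measurable_lebT_itv (i : interval R) : measurable ([set` i] : set (lebT R)).
Proof. by apply: measurable_lebT; exact: measurable_itv. Qed.

Lemma measurable_fun_lebT : measurable_fun [set: lebT R] (id : lebT R -> R).
Proof. by move=> _ A mA; rewrite setTI; exact: measurable_lebT. Qed.

Lemma leb_shift (c : R) (A : set (lebT R)) :
  leb R ((fun x => x + c) @^-1` A) = leb R A.
Proof. exact: outer_measure_shift. Qed.

Lemma ge0_integral_shift (c : R) (D : set (lebT R)) (f : R -> \bar R) :
  measurable D -> @measurable_fun _ _ (lebT R) _ D f -> (forall x, D x -> (0 <= f x)%E) ->
  (\int[leb R]_(x in ((fun x => x + c)%R @^-1` D)) f (x + c)%R =
   \int[leb R]_(x in D) f x)%E.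
Proof.
move=> mD mf f0.
rewrite -(ge0_integral_pushforward (measurable_shift c) (leb R) mD mf); last first.
  by move=> x; rewrite inE; exact: f0.
apply: eq_measure_integral; first exact: measurable_shift.
by move=> mphi A mA _; exact: leb_shift.
Qed.

Lemma ae_shift (c : R) (P : R -> Prop) :
  {ae leb R, forall x : R, P x} -> {ae leb R, forall x : R, P (x + c)}.
Proof.
move=> [N [mN N0 PN]]; exists ((fun x => x + c) @^-1` N); split.
- by have := measurable_shift c measurableT mN; rewrite setTI.
- by rewrite leb_shift.
- by move=> x /= Px; apply: PN.
Qed.

Lemma leb_aeS (P Q : R -> Prop) : (forall x, P x -> Q x) ->
  {ae leb R, forall x : R, P x} -> {ae leb R, forall x : R, Q x}.
Proof. by move=> PQ; apply: (@filterS _ _ (ae_filter_ringOfSetsType (leb R))). Qed.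

Lemma leb_aeS2 (P P' Q : R -> Prop) : (forall x, P x -> P' x -> Q x) ->
  {ae leb R, forall x : R, P x} -> {ae leb R, forall x : R, P' x} ->
  {ae leb R, forall x : R, Q x}.
Proof. by move=> PQ; apply: (@filterS2 _ _ (ae_filter_ringOfSetsType (leb R))). Qed.

End translation.

Lemma leb_ae_eq_integral (R : realType) (D : set (lebT R)) (f g : R -> \bar R) :
  measurable D -> @measurable_fun _ _ (lebT R) _ D f ->
  (forall x, D x -> (0 <= f x)%E) -> (forall x, D x -> (0 <= g x)%E) ->
  {ae leb R, forall x : R, D x -> f x = g x} ->
  (\int[leb R]_(x in D) f x = \int[leb R]_(x in D) g x)%E.
Proof.
move=> mD mf f0 g0 fg; apply: (ge0_ae_eq_integral mD mf _ f0 g0 fg).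
exact: (ae_measurable_fun (@completed_lebesgue_measure_is_complete R) fg mf).
Qed.

Lemma leb_set1 (R : realType) (a : R) : leb R [set a] = 0%E.
Proof. exact: lebesgue_measure_set1. Qed.

Lemma ae_neq_leb (R : realType) (a : R) : {ae leb R, forall x : R, x != a}.
Proof.
exists [set a]; split; first by apply: measurable_lebT; exact: measurable_set1.
  exact: leb_set1.
by move=> x /= /negP; rewrite negbK => /eqP.
Qed.

(** * Hoelder's inequality for variable exponents *)

Section varphi_theory.
Context {R : realType}.
Implicit Types (p q : \bar R) (t u w : R).

Lemma varphi_ge0 p t : (0 <= varphi p t)%E.
Proof.
by case: p => [r| |]//=; [rewrite lee_fin powR_ge0|case: ifP].
Qed.

(** For finite conjugate exponents this is Young's inequality, the factors [1 / p] and
    [1 / q] being at most [1]; if one exponent is infinite the other is [1], and the right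
    side is infinite unless the factor with infinite exponent is at most [1]. *)
Lemma young_varphi p q u w : (1 <= p)%E -> (1 <= q)%E -> (p^-1 + q^-1 = 1)%E ->
  0 <= u -> 0 <= w -> ((u * w)%:E <= varphi p u + varphi q w)%E.
Proof.
wlog : p q u w / (p = +oo)%E \/ (p \is a fin_num /\ q \is a fin_num).
  move=> wlg p1 q1 pq u0 w0.
  case: p p1 pq => [r| |] p1 pq //; last by apply: wlg => //; left.
  case: q q1 pq => [s| |] q1 pq //; first by apply: wlg => //; right.
  rewrite mulrC addeC; apply: wlg => //; first by left.
  by rewrite addeC.
move=> [-> _ q1|[pf qf] p1 q1] pq u0 w0.
  move: pq; rewrite invey add0e => /eqP; rewrite inve_eq1 => /eqP -> /=.
  case: ifPn => u1; last by rewrite addye ?leey.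
  by rewrite add0e lee_fin powRr1// ler_piMl.
case: p pf p1 pq => // r _; rewrite lee_fin => r1.
case: q qf q1 => // s _; rewrite lee_fin => s1.
have r0 : 0 < r by exact: lt_le_trans r1.
have s0 : 0 < s by exact: lt_le_trans s1.
rewrite !inver !gt_eqF// -EFinD => -[rs].
rewrite /= -EFinD lee_fin (le_trans (conjugate_powR u0 w0 r0 s0 rs))//.
by rewrite lerD// ler_pdivrMr// ler_peMr// powR_ge0.
Qed.

(** Since [p >= 1], for finite [p] the value at [0] is [0] and elsewhere
    it is [exp (p * ln t)], which is measurable in both arguments. *)
Lemma measurable_varphi d (T : measurableType d) (D : set T) (p : T -> \bar R)
    (h : T -> R) : measurable D -> measurable_fun D p -> measurable_fun D h ->
  (forall x, D x -> (1 <= p x)%E) ->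
  measurable_fun D (fun x => varphi (p x) (h x)).
Proof.
move=> mD mp mh p1.
pose F x : \bar R := if p x == +oo%E then (if (h x <= 1)%R then 0%E else +oo%E)
  else if h x == 0 then 0%E else (expR (fine (p x) * ln (h x)))%:E.
apply: (eq_measurable_fun F).
  move=> x /set_mem Dx; rewrite /F; have := p1 _ Dx.
  case: (p x) => [r| |]//=; rewrite lee_fin => r1.
  rewrite /powR; case: ifPn => // _.
  by rewrite gt_eqF// (lt_le_trans _ r1).
apply: measurable_fun_if => //.
- apply: (measurable_fun_bool true) => //.
  rewrite (_ : D `&` _ = D `&` p @^-1` [set +oo%E]); first exact: mp.
  by congr (_ `&` _); apply/seteqP; split => x /= /eqP.
- set E := D `&` _.
  have mE : measurable E.
    rewrite /E (_ : D `&` _ = D `&` p @^-1` [set +oo%E]); first exact: mp.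
    by congr (_ `&` _); apply/seteqP; split => x /= /eqP.
  apply: measurable_fun_if => //; apply: measurable_fun_ler => //.
  by apply: measurable_funS mh => // x [].
- set E := D `&` _.
  have mE : measurable E.
    rewrite /E (_ : D `&` _ = D `\` (D `&` p @^-1` [set +oo%E])).
      by apply: measurableD => //; exact: mp.
    apply/seteqP; split => x /=; first by move=> [Dx /eqP px]; split => // -[].
    by move=> [Dx px]; split => //; apply/eqP => pxy; apply: px.
  have mhE : measurable_fun E h by apply: measurable_funS mh => // x [].
  apply: measurable_fun_if => //.
    by apply: (measurable_fun_eqr mhE); exact: measurable_cst.
  apply/measurable_EFinP; apply: measurableT_comp => //.
  apply: measurable_funM.
    apply: measurableT_comp; first exact: fine_measurable.
    by apply: measurable_funS mp => // x [[]].
  by apply: measurableT_comp => //; apply: measurable_funS mh => // x [[]].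
Qed.

End varphi_theory.

Section holder.
Context {R : realType}.
Implicit Types (p q : R -> \bar R) (u w : R -> R).

Lemma Lpx_norm_ge0 p u : (0 <= Lpx_norm p u)%E.
Proof.
by apply: le_ereal_inf_tmp => _ [l [l0 _] <-]; rewrite lee_fin ltW.
Qed.

Let I01 : set (lebT R) := `[0, 1]%classic.

Let mI01 : measurable I01. Proof. exact: measurable_lebT_itv. Qed.

(** The constant [2] comes from adding the two modulars, each at most [1]. *)
Lemma holder_modular p q u w (l m : R) :
  variable_exponent p -> variable_exponent q ->
  (forall x : R, 0 <= x <= 1 -> ((p x)^-1 + (q x)^-1 = 1)%E) ->
  @measurable_fun _ _ (lebT R) R `[0, 1] u -> @measurable_fun _ _ (lebT R) R `[0, 1] w ->
  (forall x, 0 <= u x) -> (forall x, 0 <= w x) -> 0 < l -> 0 < m ->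
  (modular p (fun x => u x / l)%R <= 1)%E -> (modular q (fun x => w x / m)%R <= 1)%E ->
  (\int[leb R]_(x in `[0%R, 1%R]) (u x * w x)%:E <= (2 * l * m)%:E)%E.
Proof.
move=> [mp p1] [mq q1] pq mu mw u0 w0 l0 m0 ul wm.
have mul : @measurable_fun _ _ (lebT R) R `[0, 1] (fun x => u x / l).
  by apply: measurable_funM => //; exact: measurable_cst.
have mwm : @measurable_fun _ _ (lebT R) R `[0, 1] (fun x => w x / m).
  by apply: measurable_funM => //; exact: measurable_cst.
have inI (x : R) : `[0, 1]%classic x -> 0 <= x <= 1 by rewrite /= in_itv.
rewrite (_ : (fun x => _) = (fun x => (l * m)%:E * (u x / l * (w x / m))%:E)%E); last first.
  apply/funext => x; rewrite -EFinM; congr EFin.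
  by field; rewrite !gt_eqF.
rewrite (ge0_integralZl _ mI01); first last.
- by rewrite lee_fin mulr_ge0// ltW.
- by move=> x _; rewrite lee_fin !mulr_ge0// invr_ge0 ltW.
- by apply/measurable_EFinP; exact: measurable_funM.
rewrite (_ : (2 * l * m)%:E = ((l * m)%:E * 2%:E)%E); last first.
  by rewrite -EFinM; congr EFin; ring.
apply: lee_wpmul2l; first by rewrite lee_fin mulr_ge0// ltW.
have mvp := measurable_varphi mI01 mp mul (fun x Ix => p1 x (inI x Ix)).
have mvq := measurable_varphi mI01 mq mwm (fun x Ix => q1 x (inI x Ix)).
apply: (@le_trans _ _ (\int[leb R]_(x in `[0%R, 1%R])
   (varphi (p x) (u x / l)%R + varphi (q x) (w x / m)%R))%E).
  apply: (ge0_le_integral _ mI01).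
  - by move=> x _; rewrite lee_fin !mulr_ge0// invr_ge0 ltW.
  - by apply/measurable_EFinP; exact: measurable_funM.
  - exact: emeasurable_funD.
  - move=> x /inI Ix; apply: young_varphi; [exact: p1|exact: q1|exact: pq| |];
      by rewrite mulr_ge0// invr_ge0 ltW.
rewrite (ge0_integralD _ mI01); last 4 first.
- by move=> x _; exact: varphi_ge0.
- exact: mvp.
- by move=> x _; exact: varphi_ge0.
- exact: mvq.
by rewrite (_ : 2%:E = 1 + 1)%E ?leeD.
Qed.

(** Stated with a strict upper bound [c] for the first norm: an admissible value below [c]
    then exists even when the norm is [0] or is not attained. *)
Lemma holder_Lpx p q u w (c : R) :
  variable_exponent p -> variable_exponent q ->
  (forall x : R, 0 <= x <= 1 -> ((p x)^-1 + (q x)^-1 = 1)%E) ->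
  @measurable_fun _ _ (lebT R) R `[0, 1] u -> @measurable_fun _ _ (lebT R) R `[0, 1] w ->
  (forall x, 0 <= u x) -> (forall x, 0 <= w x) -> (Lpx_norm p u < c%:E)%E ->
  (\int[leb R]_(x in `[0%R, 1%R]) (u x * w x)%:E <= (2 * c)%:E * Lpx_norm q w)%E.
Proof.
move=> vp vq pq mu mw u0 w0 /ereal_inf_lt[_ [l [l0 ul] <-]]; rewrite lte_fin => lc.
have c0 : 0 < 2 * c by rewrite mulr_gt0// (lt_trans l0).
rewrite -lee_pdivrMl//; apply: le_ereal_inf_tmp => _ [m [m0 wm] <-].
rewrite lee_pdivrMl//; apply: (le_trans (holder_modular vp vq pq mu mw u0 w0 l0 m0 ul wm)).
by rewrite -EFinM lee_fin ler_wpM2r ?(ltW m0)// ler_wpM2l// ltW.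
Qed.

(** Modulars are integrals over a complete measure space, hence blind to null sets. *)
Lemma Lpx_norm_ae p u u' : variable_exponent p ->
  @measurable_fun _ _ (lebT R) R `[0, 1] u ->
  {ae leb R, forall x, u x = u' x} -> Lpx_norm p u = Lpx_norm p u'.
Proof.
move=> [mp p1] mu uu'; rewrite /Lpx_norm; congr ereal_inf; congr image.
apply/seteqP.
have E l : modular p (fun x => u x / l) = modular p (fun x => u' x / l).
  have mv := measurable_varphi mI01 mp (_ : measurable_fun I01 (fun x => u x / l)).
  have {}mv : measurable_fun I01 (fun x => varphi (p x) (u x / l)).
    apply: mv; first by apply: measurable_funM => //; exact: measurable_cst.
    by move=> x; rewrite /I01/= in_itv; exact: p1.
  have ae : {ae leb R, forall x, I01 x -> varphi (p x) (u x / l) = varphi (p x) (u' x / l)}.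
    by apply: leb_aeS uu' => x /= ->.
  apply: (ge0_ae_eq_integral mI01 mv _ _ _ ae).
  - exact: (ae_measurable_fun completed_lebesgue_measure_is_complete ae mv).
  - by move=> x _; exact: varphi_ge0.
  - by move=> x _; exact: varphi_ge0.
by split => l [l0 ul]; split => //; rewrite ?E// -E.
Qed.

End holder.

(** * The series of local norms controls the convolution *)

Section series_bound.
Context {R : realType} {X Y : normedModType R[i]}.
Variables (p q : R -> \bar R) (A : R -> {linear X -> Y}).
Hypotheses (vp : variable_exponent p) (vq : variable_exponent q).
Hypothesis pq : forall x : R, 0 <= x <= 1 -> ((p x)^-1 + (q x)^-1 = 1)%E.
Hypothesis sA : strongly_continuous_family A.

Definition opnorm_series (t : R) : \bar R := (\sum_(0 <= k <oo)
  Lpx_norm q (fun v => opnorm (A (v + t + k%:R)%R)))%E.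

Lemma bigcup_unit_itv (t : R) :
  \bigcup_k `](t + k%:R), (t + k%:R + 1)]%classic = `]t, +oo[%classic.
Proof.
apply/seteqP; split => x /=.
  move=> [k _]; rewrite /= !in_itv/= andbT => /andP[tx _].
  by apply: le_lt_trans tx; rewrite lerDl.
rewrite in_itv/= andbT => tx.
have ex : exists n, x <= t + n%:R.
  exists (Num.truncn (x - t)).+1; rewrite -lerBlDl ltW// truncnS_gt//.
(* The least such [n] is positive since [t < x]; its predecessor is the index sought. *)
case: (ex_minnP ex) => -[|n] xn mn; first by move: xn; rewrite addr0 leNgt tx.
exists n => //=; rewrite in_itv/= -addrA -natr1 in xn *; rewrite xn andbT.
by rewrite ltNge; apply/negP => /mn; rewrite ltnn.
Qed.

Lemma trivIset_unit_itv (t : R) :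
  trivIset setT (fun k : nat => `](t + k%:R), (t + k%:R + 1)]%classic).
Proof.
move=> i j _ _ [x /= []]; rewrite !in_itv/= => /andP[h1 h2] /andP[h3 h4].
have h5 : (i < j.+1)%N by rewrite -(ltr_nat R) -natr1; lra.
have h6 : (j < i.+1)%N by rewrite -(ltr_nat R) -natr1; lra.
by apply/eqP; rewrite eqn_leq -ltnS h5 -ltnS h6.
Qed.

(** Cut ]t, +oo[ into the intervals ]t + k, t + k + 1], translate each to the unit
    interval and apply Hoelder's inequality there; the bound [c] on the local norms of [b]
    comes out of the sum. *)
Lemma integral_opnorm_le_series (b : R -> R) (t c : R) : 0 <= t ->
  @measurable_fun _ _ (lebT R) R setT b -> (forall s, 0 <= b s) ->
  (forall k : nat, (Lpx_norm p (fun v => b (v + t + k%:R)%R) < c%:E)%E) ->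
  (\int[leb R]_(s in `]t, +oo[) (pos_opnorm A s * b s)%:E <=
   (2 * c)%:E * opnorm_series t)%E.
Proof.
move=> t0 mb b0 bc.
have c0 : 0 < c by rewrite -lte_fin (le_lt_trans (Lpx_norm_ge0 _ _) (bc 0)).
have ma : @measurable_fun _ _ (lebT R) R setT (pos_opnorm A).
  exact: (measurableT_comp (measurable_pos_opnorm sA) measurable_fun_lebT).
have mab : @measurable_fun _ _ (lebT R) _ setT (fun s => (pos_opnorm A s * b s)%:E).
  by apply/measurable_EFinP; exact: measurable_funM.
have ab0 s : (0 <= (pos_opnorm A s * b s)%:E)%E.
  by rewrite lee_fin mulr_ge0// pos_opnorm_ge0.
have mF k : measurable (`](t + k%:R), (t + k%:R + 1)]%classic : set (lebT R)).
  exact: measurable_lebT_itv.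
rewrite -(bigcup_unit_itv t) (ge0_integral_bigcup (leb R) mF (measurable_funTS mab) _
  (@trivIset_unit_itv t)); last by move=> s _; exact: ab0.
rewrite /opnorm_series -nneseriesZl; last by move=> k _; exact: Lpx_norm_ge0.
apply: lee_nneseries => [k _ _|k _]; first exact: integral_ge0.
have mk : measurable (`](t + k%:R), (t + k%:R + 1)]%classic : set (lebT R)).
  exact: measurable_lebT_itv.
rewrite -(ge0_integral_shift (t + k%:R) mk (measurable_funTS mab))//.
rewrite (_ : _ @^-1` _ = `]0, 1]%classic); last first.
  by apply/seteqP; split => x /=; rewrite !in_itv/= => h; lra.
have mbk : @measurable_fun _ _ (lebT R) R setT (fun v => b (v + t + k%:R)).
  under eq_fun do rewrite -addrA.
  exact: (measurableT_comp mb (measurable_shift (t + k%:R))).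
have mI1 : measurable (`[0, 1]%classic : set (lebT R)).
  exact: measurable_lebT_itv.
have mI2 : measurable (`]0, 1]%classic : set (lebT R)).
  exact: measurable_lebT_itv.
have mo : @measurable_fun _ _ (lebT R) R `[0, 1] (fun v => opnorm (A (v + t + k%:R))).
  rewrite (_ : `[0, 1]%classic = [set 0] `|` `]0, 1]%classic); last first.
    apply/seteqP; split => x /=; rewrite !in_itv/=.
      by case: (eqVneq x 0) => [->|x0 h]; [left|right; lra].
    by case=> [->|h]; lra.
  have m0 : measurable ([set 0] : set (lebT R)).
    by apply: measurable_lebT; exact: measurable_set1.
  apply/(measurable_funU _ m0 mI2); split; first exact: measurable_fun_set1.
  pose ash (v : R) : R := pos_opnorm A (v + (t + k%:R)).
  apply: (@eq_measurable_fun _ _ (lebT R) R _ ash).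
    move=> v /set_mem /=; rewrite in_itv/= => /andP[v0 _].
    by rewrite /ash /pos_opnorm addrA ltr_wpDr// ltr_wpDr.
  by apply: measurable_funTS; exact: (measurableT_comp ma (measurable_shift _)).
apply: le_trans (holder_Lpx vp vq pq (measurable_funTS mbk) mo _ _ (bc k)) => //.
  pose bo (v : R) := (b (v + t + k%:R) * opnorm (A (v + t + k%:R)))%:E.
  rewrite [leLHS](_ : _ = \int[leb R]_(x in `]0%R, 1%R]) bo x)%E.
    apply: (ge0_subset_integral _ mI2 mI1).
    - apply/measurable_EFinP; apply: measurable_funM; last exact: mo.
      exact: measurable_funTS.
    - by move=> v _; rewrite lee_fin mulr_ge0// opnorm_ge0.
    - by move=> v /=; rewrite !in_itv/= => /andP[/ltW -> ->].
  apply: eq_integral => v /set_mem /=; rewrite in_itv/= => /andP[v0 _].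
  by rewrite /bo /pos_opnorm addrA ltr_wpDr ?ltr_wpDr// mulrC.
by move=> v; exact: opnorm_ge0.
Qed.

End series_bound.

(** * Convolution over a half-line with a Stepanov bounded function *)

Section stepanov.
Context {R : realType} {X : normedModType R[i]}.
Variables (p : R -> \bar R) (f : R -> X).
Hypotheses (vp : variable_exponent p) (fp : stepanov_bounded p f).

Lemma stepanov_representative : exists h : R -> X,
  @separably_measurable _ (lebT R) R X h /\ {ae leb R, forall x : R, h x = f x}.
Proof.
have [[sn [vsn snf]] _ _] := fp.
have [h [mh hf _]] := ae_cvg_separably_measurable
  (measurableT : measurable [set: lebT R]) vsn snf.
exists h; split => //; apply: leb_aeS hf => x; exact.
Qed.

Lemma stepanov_norm_lt : exists c : R, forall t,
  (Lpx_norm p (fun s => rnorm (f (s + t))) < c%:E)%E.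
Proof.
have [_ _] := fp; set M := ereal_sup _ => Moo.
have M0 : (0 <= M)%E.
  apply: le_ereal_sup_tmp; exists (Lpx_norm p (fun s => rnorm (f (s + 0)))).
    by exists 0.
  exact: Lpx_norm_ge0.
exists (fine M + 1) => t; apply: (@le_lt_trans _ _ M).
  by apply: ereal_sup_ubound; exists t.
rewrite EFinD fineK ?ge0_fin_numE// lteDl// ge0_fin_numE//.
Qed.

Lemma Lpx_norm_stepanov h t : @separably_measurable _ (lebT R) R X h ->
  {ae leb R, forall x : R, h x = f x} ->
  Lpx_norm p (fun s => rnorm (h (s + t))) = Lpx_norm p (fun s => rnorm (f (s + t))).
Proof.
move=> mh hf; apply: (Lpx_norm_ae vp).
  apply: measurable_funTS.
  exact: (measurableT_comp (separably_measurable_norm mh) (measurable_shift t)).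
by apply: leb_aeS (ae_shift t hf) => x ->.
Qed.

Lemma Lpx_norm_stepanovB h t t' : @separably_measurable _ (lebT R) R X h ->
  {ae leb R, forall x : R, h x = f x} ->
  Lpx_norm p (fun s => rnorm (h (s + t) - h (s + t'))) =
  Lpx_norm p (fun s => rnorm (f (s + t) - f (s + t'))).
Proof.
move=> mh hf; apply: (Lpx_norm_ae vp).
  apply: measurable_funTS.
  have mht r := separably_measurable_comp (measurable_shift r) mh.
  exact: (separably_measurable_dist (mht t) (mht t')).
by apply: leb_aeS2 (ae_shift t hf) (ae_shift t' hf) => x -> ->.
Qed.

End stepanov.

Section convolution_tail.
Context {R : realType} {X Y : completeNormedModType R[i]}.
Variables (p q : R -> \bar R) (A : R -> {linear X -> Y}) (h : R -> X) (c : R).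
Hypotheses (vp : variable_exponent p) (vq : variable_exponent q).
Hypothesis pq : forall x : R, 0 <= x <= 1 -> ((p x)^-1 + (q x)^-1 = 1)%E.
Hypothesis sA : strongly_continuous_family A.
Hypothesis mh : @separably_measurable _ (lebT R) R X h.
Hypothesis hc : forall t, (Lpx_norm p (fun s => rnorm (h (s + t))) < c%:E)%E.

(** With [h s] for [g (- s)] this is the integrand [A s (g (t - s))]. *)
Definition tail_integrand (t s : R) : Y := pos_apply A s (h (s - t)).

Lemma separably_measurable_tail_integrand t :
  @separably_measurable _ (lebT R) R Y (tail_integrand t).
Proof.
apply: (separably_measurable_apply sA measurable_fun_lebT).
exact: (separably_measurable_comp (measurable_shift (- t)) mh).
Qed.

(** The lower end [u] of the domain is independent of the translation [t]: the continuity
    proof integrates one translate over a half-line belonging to another. *)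
Lemma integral_tail_integrand_le t u : 0 <= u ->
  (\int[leb R]_(s in `]u, +oo[) (rnorm (tail_integrand t s))%:E <=
   (2 * c)%:E * opnorm_series q A u)%E.
Proof.
move=> u0; pose b s := rnorm (h (s - t)).
have mb : @measurable_fun _ _ (lebT R) R setT b.
  apply: separably_measurable_norm.
  exact: (separably_measurable_comp (measurable_shift (- t)) mh).
have := integral_opnorm_le_series vp vq pq sA u0 mb (fun=> rnorm_ge0 _) (c := c).
move=> /(_ _) H; apply: le_trans (H _); last first.
  move=> k; rewrite /b; under [X in Lpx_norm _ X]eq_fun do rewrite -!addrA.
  exact: hc.
apply: ge0_le_integral; first exact: measurable_lebT_itv.
- by move=> s _; rewrite lee_fin rnorm_ge0.
- apply/measurable_EFinP; apply: measurable_funTS.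
  apply: separably_measurable_norm; exact: separably_measurable_tail_integrand.
- apply/measurable_EFinP; apply: measurable_funTS.
  apply: measurable_funM; last exact: mb.
  exact: (measurableT_comp (measurable_pos_opnorm sA) measurable_fun_lebT).
- by move=> s _; rewrite lee_fin ler_pos_opnorm.
Qed.

Hypothesis Soo : forall t, 0 <= t -> (opnorm_series q A t < +oo)%E.

Let c_gt0 : 0 < c.
Proof. by rewrite -lte_fin (le_lt_trans (Lpx_norm_ge0 _ _) (hc 0)). Qed.

Lemma opnorm_series_ge0 t : (0 <= opnorm_series q A t)%E.
Proof. by apply: nneseries_ge0 => k _ _; exact: Lpx_norm_ge0. Qed.

Lemma tail_integrand_integrable t u : 0 <= u ->
  bochner_integrable (leb R) `]u, +oo[ (tail_integrand t).
Proof.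
move=> u0; apply: separably_measurable_bochner_integrable.
- exact: measurable_lebT_itv.
- exact: separably_measurable_tail_integrand.
apply: le_lt_trans (integral_tail_integrand_le t u0) _.
rewrite lte_mul_pinfty// ?lee_fin ?mulr_ge0// ?(ltW c_gt0)//; exact: Soo.
Qed.

Let H t := bochner_integral (leb R) `]t, +oo[ (tail_integrand t).

Lemma rnorm_tail_le t : 0 <= t -> ((rnorm (H t))%:E <= (2 * c)%:E * opnorm_series q A t)%E.
Proof.
move=> t0; apply: le_trans (integral_tail_integrand_le t t0).
apply: ler_bochner_integral; first exact: completed_lebesgue_measure_is_complete.
exact: measurable_lebT_itv.
Qed.

Lemma tail_cvg0 : opnorm_series q A t @[t --> pinfty_nbhs R] --> 0%E ->
  H t @[t --> pinfty_nbhs R] --> (0 : Y).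
Proof.
move=> S0; apply/cvg_rnormP; apply/cvgrPdist_lt => e e0.
have e2 : 0 < e / (2 * c) by rewrite divr_gt0// mulr_gt0// c_gt0.
have := cvge0_lt_near S0 e2; have : \forall t \near pinfty_nbhs R, 0 <= t.
  by exists 0; split; [exact: num_real|move=> x /ltW].
apply: filterS2 => t t0 St; rewrite sub0r normrN subr0 ger0_norm ?rnorm_ge0//.
rewrite -lte_fin (le_lt_trans (rnorm_tail_le t0))//.
have : ((2 * c)%:E * opnorm_series q A t < (2 * c)%:E * (e / (2 * c))%:E)%E.
  by rewrite lte_pmul2l// lte_fin mulr_gt0// c_gt0.
rewrite -EFinM [X in (_ < X%:E)%E -> _](_ : _ = e)//.
by field; rewrite gt_eqF// c_gt0.
Qed.

Let measurable_tail_integrand t :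
  @measurable_fun _ _ (lebT R) R setT (fun s => rnorm (tail_integrand t s)).
Proof.
apply: separably_measurable_norm; exact: separably_measurable_tail_integrand.
Qed.

Let tail_integrand0 t s : s <= 0 -> tail_integrand t s = 0.
Proof. by move=> s0; rewrite /tail_integrand /pos_apply ltNge s0. Qed.

(** The bound involves the series at [0], whatever the domain ]t', +oo[: this makes it
    uniform in [t']. *)
Lemma tail_shift_le t t' (e : R) : 0 <= t' ->
  (forall k : nat, (Lpx_norm p (fun s =>
     rnorm (h (s + (k%:R - t')) - h (s + (k%:R - t)))%R) < e%:E)%E) ->
  ((rnorm (H t' - bochner_integral (leb R) `]t', +oo[ (tail_integrand t)))%:E <=
   (2 * e)%:E * opnorm_series q A 0)%E.
Proof.
move=> t0 he; pose b s := rnorm (h (s - t') - h (s - t)).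
have mht r := separably_measurable_comp (measurable_shift r) mh.
have mb : @measurable_fun _ _ (lebT R) R setT b.
  exact: (separably_measurable_dist (mht (- t')) (mht (- t))).
have mD : measurable (`]t', +oo[%classic : set (lebT R)) by exact: measurable_lebT_itv.
have ma : @measurable_fun _ _ (lebT R) R setT (pos_opnorm A).
  exact: (measurableT_comp (measurable_pos_opnorm sA) measurable_fun_lebT).
have := bochner_integral_dist (@completed_lebesgue_measure_is_complete R) mD mD
  (tail_integrand_integrable t' t0) (tail_integrand_integrable t t0).
move=> /le_trans; apply.
have := integral_opnorm_le_series vp vq pq sA (lexx 0) mb (fun=> rnorm_ge0 _) (c := e).
move=> /(_ _) K; apply: le_trans (K _); last first.
  move=> k; rewrite /b; under [X in Lpx_norm _ X]eq_fun do rewrite addr0 -!addrA.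
  exact: he.
rewrite [leRHS]integral_mkcond; apply: ge0_le_integral; first exact: measurableT.
- by move=> s _; rewrite lee_fin rnorm_ge0.
- apply/measurable_EFinP; apply: separably_measurable_dist;
    exact: separably_measurable_zero_outside (separably_measurable_tail_integrand _).
- apply/(measurable_restrictT _ (measurable_lebT_itv _)).
  apply: measurable_funTS; apply/measurable_EFinP; exact: measurable_funM.
- move=> s _; rewrite patchE /zero_outside.
  have ab0 : 0 <= pos_opnorm A s * b s by rewrite mulr_ge0 ?pos_opnorm_ge0 ?rnorm_ge0.
  case: ifPn => [/set_mem /=|_]; last first.
    by rewrite subrr rnorm0; case: ifP; rewrite lee_fin.
  rewrite in_itv/= andbT => ts; have s0 := le_lt_trans t0 ts.
  rewrite mem_set/= ?in_itv/= ?s0// lee_fin /tail_integrand /pos_apply s0 -linearB.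
  by rewrite (le_trans (ler_opnorm _ (sA.1 _ s0)))// /pos_opnorm s0.
Qed.

(** Absolute continuity of the integral of the single function [tail_integrand t] over a
    small interval around [t]. *)
Lemma tail_domain_near t (e : R) : 0 <= t -> 0 < e -> exists2 d : R, 0 < d &
  forall t', 0 <= t' -> `|t - t'| < d ->
    rnorm (bochner_integral (leb R) `]t', +oo[ (tail_integrand t) - H t) < e.
Proof.
move=> t0 e0.
have intti : (leb R).-integrable setT (EFin \o (fun s => rnorm (tail_integrand t s))).
  apply/integrableP; split; first by apply/measurable_EFinP.
  apply: (@le_lt_trans _ _
      (\int[leb R]_(s in `]0%R, +oo[) (rnorm (tail_integrand t s))%:E)%E).
    rewrite [leRHS]integral_mkcond; apply: ge0_le_integral; first exact: measurableT.
    - by move=> s _.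
    - by apply/measurable_EFinP; apply: measurableT_comp.
    - apply/(measurable_restrictT _ (measurable_lebT_itv _)).
      by apply: measurable_funTS; apply/measurable_EFinP.
    - move=> s _; rewrite patchE; case: ifPn => [_|].
        by rewrite /= ger0_norm ?rnorm_ge0.
      move/negP; rewrite inE/= in_itv/= andbT => /negP; rewrite -leNgt => s0.
      by rewrite /= tail_integrand0// rnorm0 normr0.
  apply: le_lt_trans (integral_tail_integrand_le t (lexx 0)) _.
  by rewrite lte_mul_pinfty// ?lee_fin ?mulr_ge0// ?(ltW c_gt0)//; exact: Soo.
have [d [d0 hd]] := integral_normr_continuous intti e0.
exists (d / 4) => [|t' t'0 tt']; first by rewrite divr_gt0.
have mD r : measurable (`]r, +oo[%classic : set (lebT R)) by exact: measurable_lebT_itv.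
pose E : set (lebT R) := `[t - d / 4, t + d / 4]%classic.
have mE : measurable E by exact: measurable_lebT_itv.
have lE : (leb R E < d%:E)%E.
  have -> : leb R E = lebesgue_measure (`[t - d / 4, t + d / 4]%classic : set R) by [].
  rewrite lebesgue_measure_itv /= lte_fin ifT; last by lra.
  by rewrite -EFinD lte_fin; lra.
have {hd} := hd E mE lE; rewrite -lte_fin => hd.
rewrite -lte_fin; apply: le_lt_trans hd.
have := bochner_integral_dist (@completed_lebesgue_measure_is_complete R) (mD t') (mD t)
  (tail_integrand_integrable t t'0) (tail_integrand_integrable t t0).
move=> /le_trans; apply.
rewrite /Rintegral (_ : (fun x => (`|_|)%:E) =
  EFin \o (fun s => rnorm (tail_integrand t s))); last first.
  by apply/funext => s /=; rewrite ger0_norm ?rnorm_ge0.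
rewrite fineK; last first.
  by apply: (integrable_fin_num mE); exact: (integrableS measurableT mE).
rewrite [leRHS]integral_mkcond; apply: ge0_le_integral; first exact: measurableT.
- by move=> s _; rewrite lee_fin rnorm_ge0.
- apply/measurable_EFinP; apply: separably_measurable_dist;
    exact: separably_measurable_zero_outside (separably_measurable_tail_integrand _).
- apply/(measurable_restrictT _ mE).
  by apply: measurable_funTS; apply/measurable_EFinP.
- move=> s _; rewrite patchE /zero_outside.
  have ge0 : (0 <= (if s \in E then (EFin \o (fun s => rnorm (tail_integrand t s))) s else 0))%E.
    by case: ifP => //; rewrite lee_fin rnorm_ge0.
  move: tt'; rewrite ltr_distlC => /andP[t1 t2].
  have memE r : (s \in `]r, +oo[%classic) = (r < s).
    by apply/idP/idP => [/set_mem|rs]; [|apply/mem_set]; rewrite /= in_itv/= andbT.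
  have inE' : t - d / 4 <= s <= t + d / 4 -> s \in E.
    by move=> ?; apply/mem_set; rewrite /E /= in_itv.
  rewrite !memE; case: ltP => h1; case: ltP => h2.
  - by rewrite subrr rnorm0.
  - by rewrite inE' ?subr0//; apply/andP; split; lra.
  - by rewrite inE' ?sub0r ?rnormN//; apply/andP; split; lra.
  - by rewrite subrr rnorm0.
Qed.

(** Change the translation first, keeping the domain ]t', +oo[, and then the domain: the
    first step is controlled by uniform continuity, the second by absolute continuity of
    one integral. *)
Lemma tail_continuous : (forall e : R, 0 < e -> exists2 delta : R, 0 < delta &
    forall t t', `|t - t'| < delta ->
      (Lpx_norm p (fun s => rnorm (h (s + t) - h (s + t'))%R) < e%:E)%E) ->
  {within `[0, +oo[, continuous H}.
Proof.
move=> uc; apply/subspace_continuousP => t /=; rewrite in_itv/= andbT => t0.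
apply/cvg_rnormP/cvgrPdist_lt => e e0.
pose S0 := fine (opnorm_series q A 0).
have S00 : 0 <= S0 by rewrite fine_ge0// opnorm_series_ge0.
have S0E : opnorm_series q A 0 = S0%:E.
  by rewrite /S0 fineK// ge0_fin_numE ?opnorm_series_ge0//; apply: Soo.
(* With this bound the change of translation costs less than [e / 2]. *)
have e1 : 0 < e / (4 * (S0 + 1)) by rewrite divr_gt0// mulr_gt0// ltr_wpDl.
have [d1 d10 h1] := uc _ e1.
have [d2 d20 h2] := tail_domain_near t0 (divr_gt0 e0 (ltr0Sn R 1)).
have d0 : 0 < Num.min d1 d2 by rewrite lt_min d10.
exists (Num.min d1 d2) => //= t'; rewrite /= lt_min => /andP[td1 td2].
rewrite in_itv/= andbT => t'0.
rewrite sub0r normrN ger0_norm ?rnorm_ge0//.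
rewrite (le_lt_trans (ler_rnorm_distD
  (bochner_integral (leb R) `]t', +oo[ (tail_integrand t)) _ _))// (splitr e).
apply: ltr_leD; last by apply: ltW; exact: h2.
have := @tail_shift_le t t' _ t'0 (fun k => h1 _ _ _).
rewrite S0E -EFinM lee_fin => hh; apply: le_lt_trans (hh _) _.
  by move=> k; have -> : k%:R - t' - (k%:R - t) = t - t' by ring.
rewrite (_ : 2 * _ * S0 = e / 2 * (S0 / (S0 + 1))); last first.
  by field; rewrite gt_eqF// ltr_wpDl.
by rewrite gtr_pMr ?divr_gt0// ltr_pdivrMr ?mul1r ?ltrDl// ltr_wpDl.
Qed.

End convolution_tail.

Lemma stepanov_convolution_tail (R : realType) (X Y : completeNormedModType R[i])
    (p q : R -> \bar R) (A : R -> {linear X -> Y}) (g : R -> X) :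
  variable_exponent p -> variable_exponent q ->
  (forall x : R, 0 <= x <= 1 -> ((p x)^-1 + (q x)^-1 = 1)%E) ->
  strongly_continuous_family A ->
  stepanov_bounded p (fun t => g (- t)) ->
  (forall t : R, 0 <= t -> (opnorm_series q A t < +oo)%E) ->
  let H1 : R -> Y := fun t =>
    bochner_integral (leb R) `]t, +oo[ (fun s : R => A s (g (t - s))) in
  [/\ forall t : R, 0 <= t ->
        bochner_integrable (leb R) `]t, +oo[ (fun s : R => A s (g (t - s))),
      Lpx_uniformly_continuous p (bochner_transform (fun t => g (- t))) ->
        {within `[0, +oo[, continuous H1} &
      opnorm_series q A t @[t --> pinfty_nbhs R] --> 0%E ->
        H1 t @[t --> pinfty_nbhs R] --> (0 : Y)].
Proof.
move=> vp vq pq sA gp Soo H1; pose gc t := g (- t).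
have [h [mh hg]] := stepanov_representative gp.
have [c gc_lt] := stepanov_norm_lt gp.
have hc (t : R) : (Lpx_norm p (fun s => rnorm (h (s + t)%R)) < c%:E)%E.
  by rewrite (Lpx_norm_stepanov vp t mh hg).
have cleb := @completed_lebesgue_measure_is_complete R.
have mD (t : R) : measurable (`]t, +oo[%classic : set (lebT R)).
  exact: measurable_lebT_itv.
have mti (t : R) := separably_measurable_tail_integrand sA mh t.
have ae_ti (t : R) : 0 <= t -> {ae leb R, forall s : R, s \in `]t, +oo[ ->
    tail_integrand A h t s = A s (g (t - s))}.
  move=> t0; apply: leb_aeS (ae_shift (- t) hg) => s hs.
  rewrite in_itv/= andbT => ts.
  by rewrite /tail_integrand /pos_apply (le_lt_trans t0 ts) hs opprB.
have H1E (t : R) : 0 <= t ->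
    H1 t = bochner_integral (leb R) `]t, +oo[ (tail_integrand A h t).
  by move=> t0; apply: (eq_bochner_integral cleb (mD t) (mti t) (ae_ti t t0)).
split.
- move=> t t0; apply/(eq_bochner_integrable cleb (mD t) (mti t) (ae_ti t t0)).
  exact: (tail_integrand_integrable vp vq pq sA mh hc Soo).
- move=> uc.
  have {}uc : forall e : R, 0 < e -> exists2 delta : R, 0 < delta &
      forall t t', `|t - t'| < delta ->
      (Lpx_norm p (fun s => rnorm (h (s + t) - h (s + t'))%R) < e%:E)%E.
    move=> e /uc[d d0 hd]; exists d => [//|t t' /hd].
    rewrite (Lpx_norm_stepanovB vp t t' mh hg) /bochner_transform.
    by under [X in Lpx_norm _ X]eq_fun do rewrite (addrC t) (addrC t').
  have := tail_continuous vp vq pq sA mh hc Soo uc.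
  apply: subspace_eq_continuous => t /set_mem/=; rewrite in_itv/= andbT => t0.
  by rewrite /from_subspace /= H1E.
- move=> S0; have := tail_cvg0 vp vq pq sA mh hc S0.
  apply: cvg_trans; apply: near_eq_cvg.
  by exists 0; split; [exact: num_real|move=> t /ltW t0; rewrite H1E].
Qed.

(** * Convolution over a bounded interval *)

Section measurable_rnorm_sum.
Context d (T : measurableType d) (R : realType) (V : normedModType R[i]).

(** Approximate the coefficient [c] by its integer parts at scale [1 / n.+1], which take
    countably many values and can therefore be frozen. *)
Lemma measurable_rnorm_scaleD (c : T -> R) (y : V) (g : T -> V) :
  measurable_fun setT c ->
  (forall v, measurable_fun setT (fun t => rnorm (g t + v))) ->
  measurable_fun setT (fun t => rnorm ((c t)%:C%C *: y + g t)).
Proof.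
move=> mc mg; pose k n t : int := Num.floor (c t * n.+1%:R).
apply: (@measurable_fun_cvg _ _ _ _ (fun n t =>
  rnorm (((k n t)%:~R / n.+1%:R)%:C%C *: y + g t))).
  move=> n; have [e ke] := countable_enum 0 (id : int -> int).
  apply: (measurable_fun_countable_range (s := k n) (c := e)
    (F := fun t z => rnorm ((z%:~R / n.+1%:R)%:C%C *: y + g t))).
  - by move=> t; have [j ej] := ke (k n t); exists j.
  - move=> z; rewrite (_ : _ @^-1` _ = (fun t => c t * n.+1%:R) @^-1` `[z%:~R, (z + 1)%:~R[).
      rewrite -[X in measurable X]setTI.
      have : measurable_fun setT (fun t => c t * n.+1%:R).
        by apply: measurable_funM => //; exact: measurable_cst.
      by apply => //; exact: measurable_itv.
    apply/seteqP; split=> t /=; rewrite in_itv/= /k.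
      by move=> <-; rewrite floor_itv.
    by move/floor_def.
  - by move=> z; under eq_fun do rewrite addrC; exact: mg.
move=> t _; apply/cvgrPdist_le => e e0.
have e1 : 0 < e / (rnorm y + 1) by rewrite divr_gt0// ltr_wpDl ?rnorm_ge0.
near=> n; rewrite (le_trans (ler_rnorm_dist _ _))// opprD addrACA subrr addr0.
rewrite -scalerBl -rmorphB rnormZ.
have n0 : 0 < n.+1%:R :> R by rewrite ltr0n.
have h1 : `|c t - (k n t)%:~R / n.+1%:R| <= n.+1%:R^-1.
  have /andP[h1 h2] := floor_itv (c t * n.+1%:R).
  rewrite ger0_norm ?subr_ge0 ?ler_pdivrMr// lerBlDr -(ler_pM2r n0) mulrDl mulVf ?gt_eqF//.
  rewrite divfK ?gt_eqF// addrC ltW//; move: h2; rewrite intrD1//.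
rewrite (le_trans (ler_wpM2r (rnorm_ge0 _) h1))//.
have h2 : n.+1%:R^-1 <= e / (rnorm y + 1).
  by apply: ltW; near: n; exact: near_infty_natSinv_lt (PosNum e1).
rewrite (le_trans (ler_wpM2r (rnorm_ge0 _) h2))//.
rewrite mulrAC ler_pdivrMr ?ltr_wpDl ?rnorm_ge0// ler_wpM2l ?lerDl// ltW//.
Unshelve. all: by end_near. Qed.

Lemma measurable_rnorm_sum (c : V -> T -> R) (r : seq V) :
  (forall y, measurable_fun setT (c y)) -> forall v : V,
  measurable_fun setT (fun t => rnorm (\sum_(y <- r) (c y t)%:C%C *: y + v)).
Proof.
move=> mc; elim: r => [|y r ih] v.
  by under eq_fun do rewrite big_nil; exact: measurable_cst.
under eq_fun do rewrite big_cons -addrA.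
apply: (@measurable_rnorm_scaleD (c y) y (fun t => \sum_(y <- r) (c y t)%:C%C *: y + v)) => // w.
by under eq_fun do rewrite -addrA; exact: ih.
Qed.

End measurable_rnorm_sum.

Section convolution.
Context {R : realType} {X Y : completeNormedModType R[i]}.
Variables (A : R -> {linear X -> Y}) (h : R -> X).
Hypothesis sA : strongly_continuous_family A.
Hypothesis mh : @separably_measurable _ (lebT R) R X h.

Definition convolution_kernel (z : lebT R * lebT R) : \bar R :=
  (pos_opnorm A (z.1 - z.2) * rnorm (h z.2))%:E.

Definition convolution_norm (t : R) : \bar R :=
  \int[leb R]_s (convolution_kernel (t, s)).

Definition convolution_integrand (z : lebT R * lebT R) : Y :=
  pos_apply A (z.1 - z.2) (h z.2).

Lemma measurable_sub_lebT :
  measurable_fun setT (fun z : lebT R * lebT R => (z.1 : R) - (z.2 : R)).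
Proof.
apply: measurable_funB.
  exact: (measurableT_comp measurable_fun_lebT measurable_fst).
exact: (measurableT_comp measurable_fun_lebT measurable_snd).
Qed.

Lemma convolution_kernel_ge0 z : (0 <= convolution_kernel z)%E.
Proof. by rewrite lee_fin mulr_ge0 ?pos_opnorm_ge0 ?rnorm_ge0. Qed.

Lemma measurable_convolution_kernel : measurable_fun setT convolution_kernel.
Proof.
apply/measurable_EFinP; apply: measurable_funM.
  exact: (measurableT_comp (measurable_pos_opnorm sA) measurable_sub_lebT).
exact: (measurableT_comp (separably_measurable_norm mh) measurable_snd).
Qed.

Lemma measurable_convolution_norm :
  @measurable_fun _ _ (lebT R) _ setT convolution_norm.
Proof.
exact: (measurable_fun_fubini_tonelli_F _ measurable_convolution_kernel
  convolution_kernel_ge0).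
Qed.

Lemma convolution_norm_ge0 t : (0 <= convolution_norm t)%E.
Proof. by apply: integral_ge0 => s _; exact: convolution_kernel_ge0. Qed.

Lemma measurable_translate_opnorm s :
  @measurable_fun _ _ (lebT R) _ setT (fun t => (pos_opnorm A (t - s))%:E : \bar R).
Proof.
apply/measurable_EFinP.
apply: (measurableT_comp (measurable_pos_opnorm sA)).
exact: (measurableT_comp measurable_fun_lebT (measurable_shift (- s))).
Qed.

(** The mass that the translate of [|A|] by [s] puts on [D]: the inner integral after
    exchanging the order of integration. *)
Definition opnorm_mass (D : set (lebT R)) (s : R) : \bar R :=
  \int[leb R]_(t in D) (pos_opnorm A (t - s)%R)%:E.

Lemma opnorm_mass_ge0 D s : (0 <= opnorm_mass D s)%E.
Proof. by apply: integral_ge0 => t _; rewrite lee_fin pos_opnorm_ge0. Qed.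

Lemma opnorm_mass_le D s : measurable D ->
  (opnorm_mass D s <= \int[leb R]_(t in `]0%R, +oo[) (opnorm (A t))%:E)%E.
Proof.
move=> mD; apply: (@le_trans _ _ (\int[leb R]_t (pos_opnorm A (t - s)%R)%:E)%E).
  apply: (ge0_subset_integral _ mD measurableT (measurable_translate_opnorm s)) => //.
  by move=> t _; rewrite lee_fin pos_opnorm_ge0.
have ma : @measurable_fun _ _ (lebT R) _ setT (fun t => (pos_opnorm A t)%:E : \bar R).
  apply/measurable_EFinP.
  exact: (measurableT_comp (measurable_pos_opnorm sA) measurable_fun_lebT).
have := ge0_integral_shift (- s) measurableT ma (fun x _ => _); rewrite preimage_setT => ->.
  rewrite [leRHS]integral_mkcond le_eqVlt; apply/orP; left; apply/eqP.
  apply: eq_integral => t _; rewrite patchE /pos_opnorm.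
  case: ifPn => [t0|t0]; first by rewrite mem_set//= in_itv/= andbT.
  by rewrite memNset//= in_itv/= andbT; exact/negP.
by move=> ?; rewrite lee_fin pos_opnorm_ge0.
Qed.

(** Tonelli's theorem for [1_D(t) |A(t - s)| |h(s)|]. *)
Lemma integral_convolution_norm (D : set (lebT R)) : measurable D ->
  (\int[leb R]_(t in D) convolution_norm t =
   \int[leb R]_s (opnorm_mass D s * (rnorm (h s))%:E))%E.
Proof.
move=> mD.
pose f (z : lebT R * lebT R) : \bar R := ((\1_D z.1)%:E * convolution_kernel z)%E.
have mf : measurable_fun setT f.
  apply: emeasurable_funM; last exact: measurable_convolution_kernel.
  apply/measurable_EFinP; apply: measurableT_comp (measurable_fst).
  exact: measurable_indic.
have f0 z : (0 <= f z)%E by rewrite mule_ge0 ?convolution_kernel_ge0// lee_fin.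
have := fubini_tonelli (m1 := leb R) (m2 := leb R) f mf f0.
rewrite [RHS](_ : _ = \int[leb R]_s (opnorm_mass D s * (rnorm (h s))%:E))%E => [<-|].
  rewrite integral_mkcond; apply: eq_integral => t _; rewrite patchE /f /=.
  rewrite indicE; case: ifPn => tD.
    by under eq_integral do rewrite mul1e.
  by under eq_integral do rewrite mul0e; rewrite integral0.
apply: eq_integral => s _; rewrite /opnorm_mass.
rewrite muleC -ge0_integralZl; first last.
- by rewrite lee_fin rnorm_ge0.
- by move=> t _; rewrite lee_fin pos_opnorm_ge0.
- by apply: measurable_funTS; exact: measurable_translate_opnorm.
- exact: mD.
rewrite [RHS]integral_mkcond; apply: eq_integral => t _; rewrite patchE /f /=.
rewrite indicE; case: ifPn => tD; last by rewrite mul0e.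
by rewrite mul1e /convolution_kernel /= EFinM muleC.
Qed.

End convolution.

Section convolution_integral.
Context {R : realType} {X Y : completeNormedModType R[i]}.
Variables (A : R -> {linear X -> Y}) (h : R -> X).
Hypothesis sA : strongly_continuous_family A.
Hypothesis Aoo : (\int[leb R]_(s in `]0%R, +oo[) (opnorm (A s))%:E < +oo)%E.
Hypothesis mh : @separably_measurable _ (lebT R) R X h.
Hypothesis hoo : (\int[leb R]_s (rnorm (h s))%:E < +oo)%E.

Let K := (\int[leb R]_(s in `]0%R, +oo[) (opnorm (A s))%:E)%E.
Let Phi := convolution_integrand A h.
Let W := convolution_norm A h.

Let K0 : (0 <= K)%E.
Proof. by apply: integral_ge0 => s _; rewrite lee_fin opnorm_ge0. Qed.

Let mrh : @measurable_fun _ _ (lebT R) _ setT (fun s => (rnorm (h s))%:E : \bar R).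
Proof. by apply/measurable_EFinP; exact: separably_measurable_norm. Qed.

Lemma measurable_opnorm_mass (D : set (lebT R)) : measurable D ->
  @measurable_fun _ _ (lebT R) _ setT (opnorm_mass A D).
Proof.
move=> mD.
pose f (z : lebT R * lebT R) : \bar R := ((\1_D z.1)%:E * (pos_opnorm A (z.1 - z.2))%:E)%E.
have mf : measurable_fun setT f.
  apply: emeasurable_funM.
    apply/measurable_EFinP; apply: measurableT_comp (measurable_fst).
    exact: measurable_indic.
  apply/measurable_EFinP.
  exact: (measurableT_comp (measurable_pos_opnorm sA) (@measurable_sub_lebT R)).
have f0 z : (0 <= f z)%E by rewrite mule_ge0 // lee_fin ?pos_opnorm_ge0.
have := measurable_fun_fubini_tonelli_G (m1 := leb R) f mf f0.
rewrite (_ : fubini_G _ f = opnorm_mass A D)//; apply/funext => s.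
rewrite /opnorm_mass /fubini_G [RHS]integral_mkcond; apply: eq_integral => t _.
by rewrite patchE /f /= indicE; case: ifPn => tD; rewrite ?mul1e ?mul0e.
Qed.

Lemma integral_convolution_norm_le (D : set (lebT R)) : measurable D ->
  (\int[leb R]_(t in D) W t <= K * \int[leb R]_s (rnorm (h s))%:E)%E.
Proof.
move=> mD; rewrite /W (integral_convolution_norm sA mh mD).
rewrite -ge0_integralZl; first last.
- exact: K0.
- by move=> s _; rewrite lee_fin rnorm_ge0.
- exact: mrh.
- exact: measurableT.
apply: ge0_le_integral; first exact: measurableT.
- by move=> s _; rewrite mule_ge0 ?opnorm_mass_ge0 ?lee_fin ?rnorm_ge0.
- by apply: emeasurable_funM; [exact: measurable_opnorm_mass|exact: mrh].
- exact: measurable_funeM.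
- move=> s _; apply: lee_wpmul2r; first by rewrite lee_fin rnorm_ge0.
  exact: opnorm_mass_le.
Qed.

Lemma integral_convolution_norm_lty (D : set (lebT R)) : measurable D ->
  (\int[leb R]_(t in D) W t < +oo)%E.
Proof.
move=> mD; apply: le_lt_trans (integral_convolution_norm_le mD) _.
have h0 : (0 <= \int[leb R]_s (rnorm (h s))%:E)%E.
  by apply: integral_ge0 => s _; rewrite lee_fin rnorm_ge0.
by rewrite lte_mul_pinfty// ge0_fin_numE.
Qed.

Lemma ae_convolution_norm_lty : {ae leb R, forall t : R, (W t < +oo)%E}.
Proof.
have iW : (leb R).-integrable setT W.
  apply/integrableP; split; first exact: measurable_convolution_norm.
  under eq_integral do rewrite gee0_abs ?convolution_norm_ge0//.
  exact: (integral_convolution_norm_lty measurableT).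
have := integrable_ae measurableT iW.
by apply: leb_aeS => t /(_ I); rewrite ge0_fin_numE// convolution_norm_ge0.
Qed.

Lemma separably_measurable_convolution_integrand : separably_measurable Phi.
Proof.
apply: (separably_measurable_apply sA (@measurable_sub_lebT R)).
exact: (separably_measurable_comp measurable_snd mh).
Qed.

Let mPhi t : @separably_measurable _ (lebT R) R Y (fun s => Phi (t, s)).
Proof.
exact: (separably_measurable_comp (pair1_measurable t)
  separably_measurable_convolution_integrand).
Qed.

Let mD (t : R) : measurable (`[0, t[%classic : set (lebT R)).
Proof. exact: measurable_lebT_itv. Qed.

Let mker t : @measurable_fun _ _ (lebT R) _ setT (fun s => convolution_kernel A h (t, s)).
Proof.
have := measurable_convolution_kernel sA mh => mk.
exact: (measurableT_comp mk (pair1_measurable (t : lebT R))).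
Qed.

Lemma integral_convolution_integrand_le t :
  (\int[leb R]_(s in `[0%R, t[) (rnorm (Phi (t, s)))%:E <= W t)%E.
Proof.
apply: (@le_trans _ _ (\int[leb R]_(s in `[0%R, t[) convolution_kernel A h (t, s))%E).
  apply: (ge0_le_integral _ (mD t)).
  - by move=> s _; rewrite lee_fin rnorm_ge0.
  - apply: measurable_funTS; apply/measurable_EFinP.
    exact: separably_measurable_norm.
  - apply: measurable_funTS.
    exact: mker.
  - by move=> s _; rewrite lee_fin ler_pos_opnorm.
apply: (ge0_subset_integral _ (mD t) measurableT).
- exact: mker.
- by move=> s _; exact: convolution_kernel_ge0.
- exact: subsetT.
Qed.

Definition convolution_integral (t : R) : Y :=
  bochner_integral (leb R) `[0, t[ (fun s => Phi (t, s)).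

Lemma convolution_integrand_integrable t : (W t < +oo)%E ->
  bochner_integrable (leb R) `[0, t[ (fun s => Phi (t, s)).
Proof.
move=> Wt; apply: separably_measurable_bochner_integrable (mD t) (mPhi t) _.
exact: le_lt_trans (integral_convolution_integrand_le t) Wt.
Qed.

Lemma rnorm_convolution_integral_le t : ((rnorm (convolution_integral t))%:E <= W t)%E.
Proof.
apply: le_trans (integral_convolution_integrand_le t).
exact: (ler_bochner_integral (@completed_lebesgue_measure_is_complete R) _ (mD t)).
Qed.

(** The coefficient of each value is the measure of a section of a measurable subset of the
    plane, hence a measurable function of [t]. *)
Lemma measurable_vsimple_section (s : lebT R * lebT R -> Y) : vsimple s ->
  @measurable_fun _ _ (lebT R) R setT
    (fun t => rnorm (vsimple_integral (leb R) `[0, t[ (fun u => s (t, u)))).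
Proof.
move=> vs; have [r ur sr] := vsimple_enum vs.
pose E y : set (lebT R * lebT R) :=
  ([set z | (0 : R) <= z.2] `&` [set z | (z.2 : R) < z.1]) `&` s @^-1` [set y].
have mE y : measurable (E y).
  apply: measurableI; last exact: vs.2.
  apply: measurableI.
    rewrite (_ : [set _ | _] = snd @^-1` (`[0, +oo[%classic : set (lebT R))).
      rewrite -[X in measurable X]setTI; apply: measurable_snd => //.
      exact: measurable_lebT_itv.
    by apply/seteqP; split => z /=; rewrite in_itv/= andbT.
  rewrite (_ : [set _ | _] = (fun z : lebT R * lebT R => (z.1 : R) - z.2) @^-1` `]0, +oo[%classic).
    rewrite -[X in measurable X]setTI; apply: (@measurable_sub_lebT R) => //.
  by apply/seteqP; split => z /=; rewrite in_itv/= andbT subr_gt0.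
pose c y (t : lebT R) : R := fine (leb R (xsection (E y) t)).
have mc y : measurable_fun setT (c y).
  apply: (measurableT_comp (fine_measurable measurableT)).
  exact: (measurable_fun_xsection (leb R) (mE y)).
have := measurable_rnorm_sum r mc 0.
apply: eq_measurable_fun => t _; rewrite addr0.
rewrite (@vsimple_integral_seq _ _ _ _ _ _ _ r)//.
apply/esym; congr rnorm; apply: eq_bigr => y _; congr ((fine (leb R _))%:C%C *: _).
apply/seteqP; split => u; rewrite /xsection /= inE /E /= in_itv/=.
  by move=> [/andP[-> ->] ->].
by move=> [[-> ->] ->].
Qed.

(** One sequence of simple functions on the plane approximates the integrand for all [t] at
    once; wherever the convolution of norms is finite, its sections compute the integral.
    Completeness of the measure takes care of the remaining null set. *)
Lemma measurable_convolution_integral :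
  @measurable_fun _ _ (lebT R) R setT (fun t => rnorm (convolution_integral t)).
Proof.
have [sn [vsn snle sncv _]] :=
  separably_measurable_approx separably_measurable_convolution_integrand.
pose b t := (W t < +oo)%E.
have mb : @measurable_fun _ _ (lebT R) _ setT b.
  apply: (measurable_fun_bool true) => //; rewrite setTI.
  rewrite (_ : _ @^-1` _ = W @^-1` (~` [set +oo%E])); last first.
    by apply/seteqP; split => t; rewrite /= /b ltey => /eqP.
  rewrite -[X in measurable X]setTI; apply: (measurable_convolution_norm sA mh).
    exact: measurableT.
  by apply: measurableC; exact: emeasurable_set1.
have mG' : @measurable_fun _ _ (lebT R) R setT
    (fun t => if b t then rnorm (convolution_integral t) else 0).
  apply: (@measurable_fun_cvg _ (lebT R) _ _ (fun n t => if b t then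
     rnorm (vsimple_integral (leb R) `[0, t[ (fun u => sn n (t, u))) else 0)).
    move=> n; apply: measurable_fun_ifT; [exact: mb| |exact: measurable_cst].
    exact: measurable_vsimple_section.
  move=> t _; case: ifPn => [Wt|_]; last exact: cvg_cst.
  have ap : bochner_approx (leb R) `[0, t[ (fun s => Phi (t, s)) (fun n u => sn n (t, u)).
    apply: (separably_measurable_bochner_approx (mD t) (mPhi t)).
    - exact: le_lt_trans (integral_convolution_integrand_le t) Wt.
    - move=> n; split.
        apply: (@sub_finite_set _ _ (range (sn n))); last exact: (vsn n).1.
        by move=> _ [u _ <-]; exists (t, u).
      move=> y; have := measurable_xsection (t : lebT R) ((vsn n).2 y).
      by rewrite xsectionE.
    - by move=> n s; exact: snle.
    - by move=> s; exact: sncv.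
  have := cvg_bochner_integral (@completed_lebesgue_measure_is_complete R) (mD t) ap.
  move=> /cvg_rnormP h1.
  have h2 : rnorm (convolution_integral t -
      vsimple_integral (leb R) `[0, t[ (fun u => sn n (t, u))) @[n --> \oo] --> (0 : R).
    by under eq_fun do rewrite rnorm_distC.
  have := cvg_rnorm_dist (v := 0) h2; rewrite subr0.
  by under eq_fun do rewrite subr0.
apply/measurable_EFinP.
apply: (ae_measurable_fun (@completed_lebesgue_measure_is_complete R)
  (f := EFin \o (fun t => if b t then rnorm (convolution_integral t) else 0))).
  by apply: leb_aeS ae_convolution_norm_lty => t Wt _; rewrite /= /b Wt.
by apply/measurable_EFinP.
Qed.

End convolution_integral.

Section finite_convolution.
Context {R : realType} {X Y : completeNormedModType R[i]}.
Variables (A : R -> {linear X -> Y}) (q : R -> X).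
Hypothesis sA : strongly_continuous_family A.
Hypothesis Aoo : (\int[leb R]_(s in `]0%R, +oo[) (opnorm (A s))%:E < +oo)%E.
Hypothesis qi : forall a : R, 0 < a -> bochner_integrable (leb R) `[0, a] q.

Let cleb := @completed_lebesgue_measure_is_complete R.
Let K := (\int[leb R]_(s in `]0%R, +oo[) (opnorm (A s))%:E)%E.

(** The function [q] is only known to be integrable on bounded intervals; cutting it off
    at [a] gives a function integrable on the line that has the same convolution up to
    time [a]. *)
Lemma local_representative (a : R) : 0 < a -> exists h : R -> X,
  [/\ @separably_measurable _ (lebT R) R X h,
      {ae leb R, forall r : R, 0 <= r <= a -> h r = q r},
      forall r, ~ (0 <= r <= a) -> h r = 0 &
      (\int[leb R]_s (rnorm (h s))%:E < +oo)%E].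
Proof.
move=> a0; have [sn qsn] := qi a0; have [vsn snq _] := qsn.
have mD : measurable (`[0, a]%classic : set (lebT R)) by exact: measurable_lebT_itv.
have [h [mh hq h0]] := ae_cvg_separably_measurable mD (fun n => (vsn n).1) snq.
exists h; split => //.
have := bochner_approx_norm_lty mD mh ((eq_bochner_approx cleb sn mD mh hq).1 qsn).
apply: le_lt_trans; rewrite [leRHS]integral_mkcond le_eqVlt; apply/orP; left.
apply/eqP; apply: eq_integral => r _; rewrite patchE; case: ifPn => // /negP rD.
by rewrite h0 ?rnorm0// => ra; apply: rD; exact/mem_set.
Qed.

Let H (t : R) : Y := bochner_integral (leb R) `[0, t[ (fun s : R => A (t - s) (q s)).

Let mI (t : R) : measurable (`[0, t[%classic : set (lebT R)).
Proof. exact: measurable_lebT_itv. Qed.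

Section with_representative.
Variables (a : R) (h : R -> X).
Hypothesis mh : @separably_measurable _ (lebT R) R X h.
Hypothesis hq : {ae leb R, forall r : R, 0 <= r <= a -> h r = q r}.
Hypothesis h0 : forall r, ~ (0 <= r <= a) -> h r = 0.
Hypothesis hoo : (\int[leb R]_s (rnorm (h s))%:E < +oo)%E.

Let mPhi t : @separably_measurable _ (lebT R) R Y
  (fun s => convolution_integrand A h (t, s)).
Proof.
exact: (separably_measurable_comp (pair1_measurable (t : lebT R))
  (separably_measurable_convolution_integrand sA mh)).
Qed.

Let aePhi t : t <= a -> {ae leb R, forall s : R, s \in `[0, t[ ->
  convolution_integrand A h (t, s) = A (t - s) (q s)}.
Proof.
move=> ta; apply: leb_aeS hq => s hs; rewrite in_itv/= => /andP[s0 st].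
rewrite /convolution_integrand /= /pos_apply subr_gt0 st hs// s0/=.
exact: le_trans (ltW st) ta.
Qed.

Lemma finite_convolution_rep t : t <= a -> H t = convolution_integral A h t.
Proof.
by move=> ta; exact: (eq_bochner_integral cleb (mI t) (mPhi t) (aePhi ta)).
Qed.

Lemma finite_convolution_integrable t : t <= a -> (convolution_norm A h t < +oo)%E ->
  bochner_integrable (leb R) `[0, t[ (fun s : R => A (t - s) (q s)).
Proof.
move=> ta Wt; apply/(eq_bochner_integrable cleb (mI t) (mPhi t) (aePhi ta)).
exact: convolution_integrand_integrable.
Qed.

Let J (u l : R) : set (lebT R) := `[u, u + l]%classic.
Let mJ u l : measurable (J u l). Proof. exact: measurable_lebT_itv. Qed.

Let mrh : @measurable_fun _ _ (lebT R) _ setT (fun s => (rnorm (h s))%:E : \bar R).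
Proof. by apply/measurable_EFinP; exact: separably_measurable_norm. Qed.

Lemma integral_rnorm_shift (f : R -> Y) t x l (G : R -> Y) :
  @measurable_fun _ _ (lebT R) R setT (fun s => rnorm (G s)) ->
  (forall s, s <= x + t + l -> f s = G s) ->
  @measurable_fun _ _ (lebT R) _ `[x, x + l] (fun v => (rnorm (f (t + v)%R))%:E : \bar R) /\
  (\int[leb R]_(v in `[x, (x + l)%R]) (rnorm (f (t + v)%R))%:E =
   \int[leb R]_(s in J (x + t) l) (rnorm (G s))%:E)%E.
Proof.
move=> mG fG.
have mG' : @measurable_fun _ _ (lebT R) _ setT (fun s => (rnorm (G s))%:E : \bar R).
  exact/measurable_EFinP.
have E v : `[x, x + l]%classic v -> f (t + v) = G (v + t).
  by rewrite /= in_itv/= => /andP[xv vx]; rewrite addrC fG//; lra.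
split.
  pose Gt (v : R) : \bar R := (rnorm (G (v + t)))%:E.
  apply: (@eq_measurable_fun _ _ (lebT R) _ _ Gt).
    by move=> v /set_mem /E ->.
  apply: measurable_funTS; exact: (measurableT_comp mG' (measurable_shift t)).
rewrite -(ge0_integral_shift t (mJ (x + t) l) (measurable_funTS mG')); last first.
  by move=> s _; rewrite lee_fin rnorm_ge0.
rewrite (_ : _ @^-1` _ = `[x, x + l]%classic); last first.
  by apply/seteqP; split => v; rewrite /J /= !in_itv/= => ?; lra.
by apply: eq_integral => v /set_mem /E ->.
Qed.

Lemma integral_opnorm_shift u l r : r <= u ->
  opnorm_mass A (J u l) r =
  (\int[leb R]_(s in `[u, (u + l)%R]) (opnorm (A (s - r)%R))%:E)%E.
Proof.
move=> ru; apply: (leb_ae_eq_integral (mJ u l)).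
- by apply: measurable_funTS; exact: measurable_translate_opnorm.
- by move=> s _; rewrite lee_fin pos_opnorm_ge0.
- by move=> s _; rewrite lee_fin opnorm_ge0.
apply: leb_aeS (ae_neq_leb r) => s sr; rewrite /J /= in_itv/= => /andP[us _].
by rewrite /pos_opnorm subr_gt0 lt_def sr (le_trans ru us).
Qed.

(** Integrate [|A(s - r)| |h(r)|] over [s] in [x + t, x + t + l], exchange the integrals and
    split at [r = x + t]. Earlier [r] give the first term; for later [r] the inner
    integral is at most the total mass of [|A|], and it vanishes beyond [x + t + l]. *)
Lemma integral_convolution_le t x l : 0 <= t -> 0 <= x -> 0 < l -> x + t + l <= a ->
  (\int[leb R]_(v in `[x, (x + l)%R]) (rnorm (H (t + v)%R))%:E <=
   \int[leb R]_(r in `[0%R, (x + t)%R])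
      ((\int[leb R]_(s in `[(x + t)%R, (x + t + l)%R])
        (opnorm (A (s - r)%R))%:E) * (rnorm (q r))%:E) +
   K * \int[leb R]_(v in `[x, (x + l)%R]) (rnorm (q (t + v)%R))%:E)%E.
Proof.
move=> t0 x0 l0 xtla.
have [_ ->] := integral_rnorm_shift (measurable_convolution_integral sA Aoo mh hoo)
  (fun s sx => finite_convolution_rep (le_trans sx xtla)).
set u := x + t.
have mm : @measurable_fun _ _ (lebT R) _ setT (opnorm_mass A (J u l)).
  exact: measurable_opnorm_mass (mJ u l).
apply: (@le_trans _ _ (\int[leb R]_(s in J u l) convolution_norm A h s)%E).
  apply: (ge0_le_integral _ (mJ u l)).
  - by move=> s _; rewrite lee_fin rnorm_ge0.
  - apply: measurable_funTS; apply/measurable_EFinP.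
    exact: measurable_convolution_integral.
  - apply: measurable_funTS; exact: measurable_convolution_norm.
  - by move=> s _; exact: rnorm_convolution_integral_le.
rewrite (integral_convolution_norm sA mh (mJ u l)).
have mP : measurable (`[0, u]%classic : set (lebT R)) by exact: measurable_lebT_itv.
have mprod : @measurable_fun _ _ (lebT R) _ setT
    (fun r => opnorm_mass A (J u l) r * (rnorm (h r))%:E)%E.
  exact: emeasurable_funM.
have -> : (\int[leb R]_(r in `[0%R, u])
      ((\int[leb R]_(s in `[u, (u + l)%R])
        (opnorm (A (s - r)%R))%:E) * (rnorm (q r))%:E) =
    \int[leb R]_(r in `[0%R, u]) (opnorm_mass A (J u l) r * (rnorm (h r))%:E))%E.
  apply/esym; apply: (leb_ae_eq_integral mP).
  - exact: measurable_funTS.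
  - by move=> r _; rewrite mule_ge0 ?opnorm_mass_ge0 ?lee_fin ?rnorm_ge0.
  - move=> r _; rewrite mule_ge0 ?lee_fin ?rnorm_ge0// integral_ge0// => s _.
    by rewrite lee_fin opnorm_ge0.
  apply: leb_aeS hq => r hr; rewrite /= in_itv/= => /andP[r0 ru].
  rewrite hr; last by rewrite r0/=; rewrite /u in ru; lra.
  by rewrite integral_opnorm_shift.
have -> : (\int[leb R]_(v in `[x, (x + l)%R]) (rnorm (q (t + v)%R))%:E =
    \int[leb R]_(s in J u l) (rnorm (h s))%:E)%E.
  have mxl : measurable (`[x, x + l]%classic : set (lebT R)).
    exact: measurable_lebT_itv.
  rewrite -(ge0_integral_shift t (mJ u l) (measurable_funTS mrh)); last first.
    by move=> s _; rewrite lee_fin rnorm_ge0.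
  rewrite (_ : _ @^-1` _ = `[x, x + l]%classic); last first.
    by apply/seteqP; split => v; rewrite /J /u /= !in_itv/= => ?; lra.
  apply/esym; apply: (leb_ae_eq_integral mxl).
  - apply: measurable_funTS; exact: (measurableT_comp mrh (measurable_shift t)).
  - by move=> v _; rewrite lee_fin rnorm_ge0.
  - by move=> v _; rewrite lee_fin rnorm_ge0.
  apply: leb_aeS (ae_shift t hq) => v hv; rewrite /= in_itv/= => /andP[xv vx].
  by rewrite [in RHS]addrC hv//; lra.
rewrite -ge0_integralZl; first last.
- by apply: integral_ge0 => s _; rewrite lee_fin opnorm_ge0.
- by move=> s _; rewrite lee_fin rnorm_ge0.
- exact: measurable_funTS.
- exact: mJ.
rewrite [X in (_ <= X + _)%E]integral_mkcond [X in (_ <= _ + X)%E]integral_mkcond.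
have mF : @measurable_fun _ _ (lebT R) _ setT
   ((fun r => opnorm_mass A (J u l) r * (rnorm (h r))%:E)%E \_ (`[0, u]%classic)).
  by apply/(measurable_restrictT _ mP); exact: measurable_funTS.
have mG : @measurable_fun _ _ (lebT R) _ setT
   ((fun r => K * (rnorm (h r))%:E)%E \_ (J u l)).
  apply/(measurable_restrictT _ (mJ u l)); apply: measurable_funTS.
  exact: measurable_funeM.
have prod0 r : (0 <= opnorm_mass A (J u l) r * (rnorm (h r))%:E)%E.
  by rewrite mule_ge0 ?opnorm_mass_ge0 ?lee_fin ?rnorm_ge0.
have K0 : (0 <= K)%E by apply: integral_ge0 => s _; rewrite lee_fin opnorm_ge0.
have Kprod0 r : (0 <= K * (rnorm (h r))%:E)%E by rewrite mule_ge0 ?lee_fin ?rnorm_ge0.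
have F0 r :
    (0 <= ((fun r => opnorm_mass A (J u l) r * (rnorm (h r))%:E) \_ (`[0%R, u]%classic)) r)%E.
  by rewrite patchE; case: ifP.
have G0 r : (0 <= ((fun r => K * (rnorm (h r))%:E) \_ (J u l)) r)%E.
  by rewrite patchE; case: ifP.
rewrite -(ge0_integralD _ measurableT _ mF _ mG)//.
apply: (ge0_le_integral _ measurableT).
- by move=> r _; exact: prod0.
- exact: mprod.
- exact: (emeasurable_funD mF mG).
move=> r _.
have [r0|r0] := ltP r 0.
  rewrite h0 ?rnorm0 ?mule0 ?adde_ge0//; by rewrite leNgt r0.
have [ru|ur] := leP r u.
  rewrite [X in (_ <= X + _)%E]patchE mem_set/= ?in_itv/= ?r0//.
  by rewrite leeDl.
have [rul|ulr] := leP r (u + l).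
  have rJ : J u l r by rewrite /J /= in_itv/= (ltW ur).
  rewrite [X in (_ <= _ + X)%E]patchE (mem_set rJ).
  apply: (@le_trans _ _ (K * (rnorm (h r))%:E)%E); last by rewrite leeDr.
  apply: lee_wpmul2r; first by rewrite lee_fin rnorm_ge0.
  exact: opnorm_mass_le.
have Z : opnorm_mass A (J u l) r = 0%E.
  rewrite /opnorm_mass; apply: integral0_eq => s; rewrite /J /= in_itv/= => /andP[_ sul].
  by rewrite /pos_opnorm subr_gt0 ltNge (le_trans sul (ltW ulr)).
by rewrite Z mul0e adde_ge0.
Qed.

End with_representative.
End finite_convolution.

(** * Equi-Weyl vanishing functions *)

Section weyl_limits.
Context {R : realType}.

Lemma limf_esup_pinfty_lt (u : R -> \bar R) (e : \bar R) :
  (limf_esup u (pinfty_nbhs R) < e)%E ->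
  exists2 T : R, 0 <= T & forall t, T < t -> (u t < e)%E.
Proof.
move=> /ereal_inf_lt[_ [B [T [_ TB]] <-] Be].
exists (Num.max T 0); first by rewrite le_max lexx orbT.
move=> t; rewrite gt_max => /andP[Tt _]; apply: le_lt_trans Be.
by apply: ereal_sup_ubound; exists t => //; exact: TB.
Qed.

Lemma limf_esup_pinfty_le (u : R -> \bar R) (e : \bar R) (T : R) :
  (forall t, T < t -> (u t <= e)%E) -> (limf_esup u (pinfty_nbhs R) <= e)%E.
Proof.
move=> ue; apply: ge_ereal_inf; exists (ereal_sup [set u t | t in [set t | T < t]]).
  by exists [set t | T < t] => //; exists T; split => //; exact: num_real.
by apply: ge_ereal_sup => _ [t Tt <-]; exact: ue.
Qed.

Lemma limf_esup_pinfty_ge0 (u : R -> \bar R) (T : R) : (forall t, T < t -> (0 <= u t)%E) ->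
  (0 <= limf_esup u (pinfty_nbhs R))%E.
Proof.
move=> u0; apply: le_ereal_inf_tmp => _ [B [T' [_ TB]] <-].
pose t := Num.max T T' + 1.
have [Tt T't] : T < t /\ T' < t.
  by split; rewrite /t ltr_pwDr// le_max lexx ?orbT.
apply: le_trans (u0 _ Tt) _; apply: ereal_sup_ubound.
by exists t => //; exact: TB.
Qed.

End weyl_limits.

(** Multiply the estimate [integral_convolution_le] by [F1]: the first term is small by
    hypothesis, and since [F1 <= M * F] the second is at most [M] times the mass of [|A|]
    times the quantity that vanishes for [q]. *)
Lemma equi_Weyl_convolution (R : realType) (X Y : completeNormedModType R[i])
    (A : R -> {linear X -> Y}) (F F1 : R -> R -> R) (q : R -> X) :
  strongly_continuous_family A ->
  (\int[leb R]_(s in `]0%R, +oo[) (opnorm (A s))%:E < +oo)%E ->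
  (forall l t : R, 0 < l -> 0 <= t -> 0 < F l t) ->
  (forall l t : R, 0 < l -> 0 <= t -> 0 < F1 l t) ->
  (forall a : R, 0 < a -> bochner_integrable (leb R) `[0, a] q) ->
  equi_Weyl_vanishing F q ->
  (forall e : R, 0 < e ->
    exists2 l0 : R, 0 < l0 & forall l : R, l0 < l ->
    exists2 t0 : R, 0 < t0 & forall t : R, t0 <= t ->
      (ereal_sup [set (F1 l t)%:E *
          \int[leb R]_(r in `[0%R, (x + t)%R])
            ((\int[leb R]_(s in `[(x + t)%R, (x + t + l)%R])
                (opnorm (A (s - r)%R))%:E) * (rnorm (q r))%:E)
        | x in [set x : R | (0 <= x)%R]] < e%:E)%E) ->
  (exists2 M : R, 0 < M &
    forall l t : R, 0 < l -> 0 <= t -> F1 l t / F l t <= M) ->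
  let H2 : R -> Y := fun t =>
    bochner_integral (leb R) `[0, t[ (fun s : R => A (t - s) (q s)) in
  {ae leb R, forall t : R, 0 <= t ->
    bochner_integrable (leb R) `[0, t[ (fun s : R => A (t - s) (q s))} /\
  equi_Weyl_vanishing F1 H2.
Proof.
move=> sA Aoo F0 F10 qi [qint qlim] hyp [M M0 FM] H2.
split.
  (* Countably many null sets, one for each time horizon. *)
  have ae_n (n : nat) : {ae leb R, forall t : R, t <= n.+1%:R ->
      bochner_integrable (leb R) `[0, t[ (fun s : R => A (t - s) (q s))}.
    have [h [mh hq h0 hoo]] := local_representative qi (ltr0Sn R n).
    apply: leb_aeS (ae_convolution_norm_lty sA Aoo mh hoo) => t Wt tn.
    exact: (finite_convolution_integrable sA mh hq tn Wt).
  have := ae_foralln ae_n; apply: leb_aeS => t ht _.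
  by apply: (ht (Num.truncn t)); rewrite ltW// truncnS_gt.
split.
  move=> t x l t0 x0 l0.
  have a0 : 0 < x + t + l by rewrite !addr_gt0.
  have [h [mh hq h0 hoo]] := local_representative qi a0.
  have [mH EH] := integral_rnorm_shift
    (measurable_convolution_integral sA Aoo mh hoo)
    (fun s sx => finite_convolution_rep sA mh hq sx).
  apply/integrableP; split; first exact: mH.
  have mJ : measurable (`[x + t, x + t + l]%classic : set (lebT R)).
    exact: measurable_lebT_itv.
  apply: (@le_lt_trans _ _ (\int[leb R]_(s in `[(x + t)%R, (x + t + l)%R])
      (rnorm (convolution_integral A h s))%:E)%E).
    rewrite le_eqVlt; apply/orP; left; apply/eqP; apply: etrans EH.
    by apply: eq_integral => v _; rewrite gee0_abs// lee_fin; exact: rnorm_ge0.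
  apply: le_lt_trans (integral_convolution_norm_lty sA Aoo mh hoo mJ).
  apply: (ge0_le_integral _ mJ).
  - by move=> s _; rewrite lee_fin rnorm_ge0.
  - apply: measurable_funTS; apply/measurable_EFinP.
    exact: measurable_convolution_integral.
  - apply: measurable_funTS; exact: measurable_convolution_norm.
  - by move=> s _; exact: rnorm_convolution_integral_le.
set K := (\int[leb R]_(s in `]0%R, +oo[) (opnorm (A s))%:E)%E in Aoo.
have K0 : (0 <= K)%E by apply: integral_ge0 => s _; rewrite lee_fin opnorm_ge0.
pose k := fine K.
have KE : K = k%:E by rewrite /k fineK// ge0_fin_numE.
have k0 : 0 <= k by rewrite fine_ge0.
pose P l t x := (\int[leb R]_(r in `[0%R, (x + t)%R])
            ((\int[leb R]_(s in `[(x + t)%R, (x + t + l)%R])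
                (opnorm (A (s - r)%R))%:E) * (rnorm (q r))%:E))%E.
pose Q l t x := (\int[leb R]_(v in `[x, (x + l)%R]) (rnorm (q (t + v)%R))%:E)%E.
have Q0 l t x : (0 <= Q l t x)%E.
  by apply: integral_ge0 => s _; rewrite lee_fin rnorm_ge0.
have bound l t x : 0 <= t -> 0 <= x -> 0 < l ->
    (\int[leb R]_(v in `[x, (x + l)%R]) (rnorm (H2 (t + v)%R))%:E <=
     P l t x + K * Q l t x)%E.
  move=> t0 x0 l0; have a0 : 0 < x + t + l by rewrite ltr_wpDl ?addr_ge0.
  have [h [mh hq h0 hoo]] := local_representative qi a0.
  exact: (integral_convolution_le sA Aoo mh hq h0 hoo t0 x0 l0 (lexx _)).
pose U l t := ereal_sup [set ((F l t)%:E * Q l t x)%E | x in [set x : R | (0 <= x)%R]].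
pose V l t := ereal_sup [set ((F1 l t)%:E *
  \int[leb R]_(v in `[x, (x + l)%R]) (rnorm (H2 (t + v)%R))%:E)%E
  | x in [set x : R | (0 <= x)%R]].
apply: ge0_cvge0.
  exists 0; split; [exact: num_real|move=> l l0].
  apply: (@limf_esup_pinfty_ge0 _ _ 0) => t t0.
  apply: (@le_trans _ _ ((F1 l t)%:E *
     \int[leb R]_(v in `[0%R, (0 + l)%R]) (rnorm (H2 (t + v)%R))%:E)%E).
    rewrite mule_ge0 ?lee_fin ?(ltW (F10 _ _ l0 (ltW t0)))// integral_ge0// => v _.
    by rewrite lee_fin rnorm_ge0.
  by apply: ereal_sup_ubound; exists 0 => /=.
move=> e e0.
have Mk0 : 0 < M * k + 1 by rewrite ltr_wpDl// mulr_ge0// ltW.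
(* [M * k] times this bound is at most [e / 3], also when [k = 0]. *)
have e1 : 0 < e / (3 * (M * k + 1)) by rewrite divr_gt0// mulr_gt0.
have e3 : 0 < e / 3 by rewrite divr_gt0.
have [l0 l00 hl0] := hyp _ e3.
have lmin : \forall l \near pinfty_nbhs R, Num.max l0 0 < l.
  by exists (Num.max l0 0); split => //; exact: num_real.
have := cvge0_lt_near qlim e1; apply: filterS2 lmin => l.
rewrite gt_max => /andP[l0l lp] /limf_esup_pinfty_lt[T T0 hT].
have [t0 t00 ht0] := hl0 _ l0l.
apply: (@le_lt_trans _ _ (e / 3 + e / 3)%:E); last by rewrite lte_fin; lra.
apply: (@limf_esup_pinfty_le _ _ _ (Num.max T t0)) => t.
rewrite gt_max => /andP[Tt t0t].
have tp : 0 <= t by exact: le_trans (ltW Tt).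
have hP := ht0 _ (ltW t0t); have hU := hT _ Tt.
apply: ge_ereal_sup => _ [x /= x0 <-].
have F1p := F10 _ _ lp tp; have Fp := F0 _ _ lp tp.
apply: (@le_trans _ _ ((F1 l t)%:E * (P l t x + K * Q l t x))%E).
  by apply: lee_wpmul2l; [rewrite lee_fin ltW|exact: bound].
have P0 : (0 <= P l t x)%E.
  apply: integral_ge0 => r _; rewrite mule_ge0 ?lee_fin ?rnorm_ge0//.
  by apply: integral_ge0 => s _; rewrite lee_fin opnorm_ge0.
rewrite ge0_muleDr ?mule_ge0// EFinD; apply: leeD.
  apply: ltW; apply: le_lt_trans hP.
  by apply: ereal_sup_ubound; exists x.
have FQ : ((F l t)%:E * Q l t x <= (e / (3 * (M * k + 1)))%:E)%E.
  apply: ltW; apply: le_lt_trans hU.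
  by apply: ereal_sup_ubound; exists x.
rewrite KE muleA -EFinM.
apply: (@le_trans _ _ ((M * k)%:E * ((F l t)%:E * Q l t x))%E).
  rewrite muleA -EFinM; apply: lee_wpmul2r; first exact: Q0.
  rewrite lee_fin mulrAC ler_wpM2r//.
  by have := FM _ _ lp tp; rewrite ler_pdivrMr.
apply: (@le_trans _ _ ((M * k)%:E * (e / (3 * (M * k + 1)))%:E)%E).
  by apply: lee_wpmul2l => //; rewrite lee_fin mulr_ge0// ltW.
rewrite -EFinM lee_fin.
rewrite (_ : M * k * _ = e / 3 * (M * k / (M * k + 1))); last first.
  by field; rewrite gt_eqF.
by rewrite ler_piMr ?(ltW e3)// ler_pdivrMr// mul1r lerDl.
Qed.

(** * The convolution theorem *)

Theorem proposition4p11 (R : realType) (X Y : completeNormedModType R[i]) :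
  (forall (p q : R -> \bar R) (A : R -> {linear X -> Y}) (g : R -> X),
    variable_exponent p -> variable_exponent q ->
    (forall x : R, 0 <= x <= 1 -> ((p x)^-1 + (q x)^-1 = 1)%E) ->
    strongly_continuous_family A ->
    stepanov_bounded p (fun t => g (- t)) ->
    let S : R -> \bar R := fun t => (\sum_(0 <= k <oo)
      Lpx_norm q (fun v => opnorm (A (v + t + k%:R)%R)))%E in
    (forall t : R, 0 <= t -> (S t < +oo)%E) ->
    let H1 : R -> Y := fun t =>
      bochner_integral (leb R) `]t, +oo[ (fun s : R => A s (g (t - s))) in
    [/\ forall t : R, 0 <= t ->
          bochner_integrable (leb R) `]t, +oo[ (fun s : R => A s (g (t - s))),
        Lpx_uniformly_continuous p (bochner_transform (fun t => g (- t))) ->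
          {within `[0, +oo[, continuous H1} &
        S t @[t --> pinfty_nbhs R] --> 0%E -> H1 t @[t --> pinfty_nbhs R] --> (0 : Y)]) /\
  (forall (A : R -> {linear X -> Y}) (F F1 : R -> R -> R) (q : R -> X),
    strongly_continuous_family A ->
    (\int[leb R]_(s in `]0%R, +oo[) (opnorm (A s))%:E < +oo)%E ->
    (forall l t : R, 0 < l -> 0 <= t -> 0 < F l t) ->
    (forall l t : R, 0 < l -> 0 <= t -> 0 < F1 l t) ->
    (forall a : R, 0 < a -> bochner_integrable (leb R) `[0, a] q) ->
    equi_Weyl_vanishing F q ->
    (forall e : R, 0 < e ->
      exists2 l0 : R, 0 < l0 & forall l : R, l0 < l ->
      exists2 t0 : R, 0 < t0 & forall t : R, t0 <= t ->
        (ereal_sup [set (F1 l t)%:E *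
            \int[leb R]_(r in `[0%R, (x + t)%R])
              ((\int[leb R]_(s in `[(x + t)%R, (x + t + l)%R])
                  (opnorm (A (s - r)%R))%:E) * (rnorm (q r))%:E)
          | x in [set x : R | (0 <= x)%R]] < e%:E)%E) ->
    (exists2 M : R, 0 < M &
      forall l t : R, 0 < l -> 0 <= t -> F1 l t / F l t <= M) ->
    let H2 : R -> Y := fun t =>
      bochner_integral (leb R) `[0, t[ (fun s : R => A (t - s) (q s)) in
    {ae leb R, forall t : R, 0 <= t ->
      bochner_integrable (leb R) `[0, t[ (fun s : R => A (t - s) (q s))} /\
    equi_Weyl_vanishing F1 H2).
Proof.
split; last by move=> A F F1 q; exact: equi_Weyl_convolution.
move=> p q A g vp vq pq sA gp S Soo.
exact: (stepanov_convolution_tail vp vq pq sA gp Soo).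
Qed.
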